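(* Let $Z\in\mathbb{S}^n$ be diagonal, with the eigenvalue and block notation of the context. Then for all $H,W\in\mathbb{S}^n$ the blocks of $M:=\Pi_+''(Z;H,W)$ are as follows (blocks involving the index $0$ are absent if $0$ is not an eigenvalue of $Z$). For $a,b\in\Omega_+$: $$M_{ab}=W_{ab}+2\sum_{c\in\Omega_-}\frac{-\lambda_c}{(\lambda_c-\lambda_a)(\lambda_c-\lambda_b)}H_{ac}H_{cb}.$$ For $a\in\Omega_+$: $$M_{a0}=W_{a0}+2\sum_{c\in\Omega_-}\frac{1}{\lambda_a-\lambda_c}H_{ac}H_{c0}-\frac{2}{\lambda_a}H_{a0}\Pi_+(-H_{00}).$$ For $a\in\Omega_+$, $b\in\Omega_-$: $$M_{ab}=\frac{\lambda_a}{\lambda_a-\lambda_b}W_{ab}+2\sum_{c\in\Omega_+}\frac{-\lambda_b}{(\lambda_b-\lambda_a)(\lambda_b-\lambda_c)}H_{ac}H_{cb}+\frac{2}{\lambda_a-\lambda_b}H_{a0}H_{0b}+2\sum_{c\in\Omega_-}\frac{\lambda_a}{(\lambda_a-\lambda_b)(\lambda_a-\lambda_c)}H_{ac}H_{cb}.$$ The zero block: $$M_{00}=2\sum_{c\in\Omega_+}\frac{1}{\lambda_c}H_{0c}H_{c0}+\Pi_+'(H_{00};V_0),\qquad V_0:=W_{00}-2\sum_{l\in\Omega_+\cup\Omega_-}\frac{1}{\lambda_l}H_{0l}H_{l0}.$$ For $b\in\Omega_-$: $$M_{0b}=2\sum_{c\in\Omega_+}\frac{1}{\lambda_c-\lambda_b}H_{0c}H_{cb}+\frac{2}{-\lambda_b}\Pi_+(H_{00})H_{0b}.$$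 For $a,b\in\Omega_-$: $$M_{ab}=2\sum_{c\in\Omega_+}\frac{\lambda_c}{(\lambda_c-\lambda_a)(\lambda_c-\lambda_b)}H_{ac}H_{cb}.$$ The remaining blocks follow by symmetry: $M_{lk}=M_{kl}^{\mathsf T}$. Moreover, for a general (not necessarily diagonal) $Z\in\mathbb{S}^n$ and any orthogonal $Q$ such that $\tilde Z:=Q^{\mathsf T}ZQ$ is diagonal, $$\Pi_+''(Z;H,W)=Q\,\Pi_+''(\tilde Z;Q^{\mathsf T}HQ,Q^{\mathsf T}WQ)\,Q^{\mathsf T}.$$
   Context: $\mathbb{S}^k$ is the space of real symmetric $k\times k$ matrices with the Frobenius inner product, and $\Pi_+$ denotes the orthogonal projection onto the positive semidefinite cone (in whichever $\mathbb{S}^k$ is relevant). Directional derivatives: $$\Pi_+'(Z;H):=\lim_{t\downarrow0}\frac{\Pi_+(Z+tH)-\Pi_+(Z)}{t},\qquad \Pi_+''(Z;H,W):=\lim_{t\downarrow0}\frac{\Pi_+(Z+tH+\tfrac{t^2}{2}W)-\Pi_+(Z)-t\Pi_+'(Z;H)}{t^2/2}.$$ For diagonal $Z$: - $\{\lambda_a\}_{a\in\Omega_+}$ are the distinct positive eigenvalues of $Z$ and $\{\lambda_b\}_{b\in\Omega_-}$ the distinct negative ones; - if $0$ is an eigenvalue it is indexed by $0$ with $\lambda_0=0$; - $\alpha_k:=\{i:Z_{ii}=\lambda_k\}$. For a matrix $M$, $M_{kl}$ denotes the submatrix with rows in $\alpha_k$ and columns in $\alpha_l$. Thus $H_{00}\in\mathbb{S}^{|\alpha_0|}$,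 and $\Pi_+(H_{00})$, $\Pi_+(-H_{00})$, $\Pi_+'(H_{00};V_0)$ are taken in $\mathbb{S}^{|\alpha_0|}$. *)

(* Defs.v *)
From HB Require Import structures.
From mathcomp Require Import all_boot all_order all_algebra.
From mathcomp Require Import all_classical all_reals all_analysis.
Set Implicit Arguments. Unset Strict Implicit. Unset Printing Implicit Defensive.
Import Order.TTheory GRing.Theory Num.Theory numFieldTopology.Exports numFieldNormedType.Exports.
Local Open Scope ring_scope.
Local Open Scope classical_set_scope.

Section Defs.
Context {R : realType}.

Definition symmx {k} (A : 'M[R]_k) : Prop := A^T = A.

Definition psdmx {k} (A : 'M[R]_k) : Prop :=
  symmx A /\ forall v : 'cV[R]_k, 0 <= (v^T *m A *m v) 0 0.

Definition frob2 {k} (A : 'M[R]_k) : R := \sum_i \sum_j A i j ^+ 2.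

Definition is_proj_psd {k} (Z P : 'M[R]_k) : Prop :=
  psdmx P /\ forall X, psdmx X -> frob2 (Z - P) <= frob2 (Z - X).

(* Pi_+ : the projection onto the PSD cone (the minimizer exists and is unique) *)
Definition Pi_plus {k} (Z : 'M[R]_k) : 'M[R]_k :=
  xget 0 [set P | is_proj_psd Z P].

Definition dd1_quot {k} (Z H : 'M[R]_k) (t : R) : 'M[R]_k :=
  t^-1 *: (Pi_plus (Z + t *: H) - Pi_plus Z).

Definition Pi_plus' {k} (Z H : 'M[R]_k) : 'M[R]_k :=
  lim (dd1_quot Z H @ 0^'+).

Definition dd2_quot {k} (Z H W : 'M[R]_k) (t : R) : 'M[R]_k :=
  ((t ^+ 2) / 2)^-1 *:
    (Pi_plus (Z + t *: H + ((t ^+ 2) / 2) *: W) - Pi_plus Z - t *: Pi_plus' Z H).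

Definition Pi_plus'' {k} (Z H W : 'M[R]_k) : 'M[R]_k :=
  lim (dd2_quot Z H W @ 0^'+).

Definition zidx {n} (Z : 'M[R]_n) : {set 'I_n} := [set i | Z i i == 0].

Definition sub00 {n} (Z A : 'M[R]_n) : 'M[R]_#|zidx Z| :=
  \matrix_(p, q) A (enum_val p) (enum_val q).

End Defs.

(* Main.v *)
Require Import Defs.
From HB Require Import structures.
From mathcomp Require Import all_boot all_order all_algebra.
From mathcomp Require Import all_classical all_reals all_analysis.
From mathcomp Require Import complex ring lra.
Set Implicit Arguments. Unset Strict Implicit. Unset Printing Implicit Defensive.
Import Order.TTheory GRing.Theory Num.Theory numFieldTopology.Exports numFieldNormedType.Exports.
Local Open Scope ring_scope.
Local Open Scope classical_set_scope.

(** Put A(t) = Z + t H + t^2/2 W, P(t) = Pi_+(A(t)) and N(t) = P(t) - A(t).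
    By Moreau's theorem P and N are characterised by: both are PSD and
    P N = 0. As Pi_+ is nonexpansive, p = P - Z_+ and q = N - Z_- are O(t)
    entrywise, and P N = 0 reads
      (Z_+)_ii q_ij + p_ij (Z_-)_jj + sum_k p_ik q_kj = 0.
    Together with p - q = A - Z this determines p_ij to one order more than
    what is known of p and q, for every (i, j) with (Z_+)_ii + (Z_-)_jj <> 0;
    by symmetry only the zero block is left. There, the Schur complements of P
    relative to the positive block and of N relative to the negative block are
    again PSD with zero product, so the first one is exactly Pi_+ of their
    difference, which is t H_00 + t^2/2 V_0 + O(t^3). The directional
    derivative of Pi_+ at the non-diagonal matrix H_00 exists because H_00 is
    orthogonally diagonalisable. *)

(** * Spectral theorem for real symmetric matrices *)

(** Over [R[i]] the matrix is hermitian, so its spectrum is real; a real scalar that is an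
    eigenvalue after the field extension is one before it. *)
Lemma symmetric_eigenvalue (R : rcfType) n (A : 'M[R]_n.+1) :
  A^T = A -> exists a, eigenvalue A a.
Proof.
move=> sA; pose f : {rmorphism R -> R[i]%C} := real_complex R.
pose AC := map_mx f A.
have hA : AC \is hermsymmx.
  apply: realsym_hermsym.
    by apply/is_hermitianmxP; rewrite expr0 scale1r map_mx_id // map_trmx sA.
  by apply/mxOverP => i j; rewrite mxE complex_real.
have /hermitian_normalmx /orthomx_spectralP eA := hA.
have /mxOverP/(_ 0 0) := hermitian_spectral_diag_real hA.
case e : (spectral_diag AC 0 0) => [a b]; rewrite complex_real => /eqP b0.
exists a; rewrite -(eigenvalue_map f).
have -> : f a = spectral_diag AC 0 0 by rewrite e b0.
apply/eigenvalueP; exists (row 0 (spectralmx AC)).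
  rewrite -/AC [X in _ *m X]eA !mulmxA -row_mul mulmxV ?spectral_unit // row1.
  by rewrite -rowE row_diag_mx -scalemxAl -rowE.
apply/eqP => h; have /(congr1 (row 0)) := mulmxV (spectral_unit AC).
rewrite row_mul h mul0mx => /matrixP/(_ 0 0); rewrite !mxE /= => /esym/eqP.
by rewrite oner_eq0.
Qed.

(** Used for deflation: it completes a unit eigenvector to an orthogonal matrix. *)
Lemma householder (R : rcfType) n (v : 'cV[R]_n.+1) : v^T *m v = 1%:M ->
  exists2 Q : 'M[R]_n.+1, Q^T *m Q = 1%:M & Q *m delta_mx 0 0 = v.
Proof.
move=> vv; pose e : 'cV[R]_n.+1 := delta_mx 0 0.
have [->|nz] := eqVneq v e.
  by exists 1%:M; rewrite ?trmx1 mul1mx.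
(* The reflection exchanging v and e_0. *)
pose w := v - e; pose c := (1 - v 0 0)^-1.
have ew : (w^T *m e) = (v 0 0 - 1)%:M.
  by apply/matrixP=> i j; rewrite !ord1 /e -colE !mxE eqxx.
have ww : (w^T *m w) = (2 * (1 - v 0 0))%:M.
  rewrite {2}/w mulmxBr ew /w linearB /= mulmxBl vv.
  have -> : e^T *m v = (v 0 0)%:M.
    by apply/matrixP=> i j; rewrite !ord1 /e trmx_delta -rowE !mxE.
  by rewrite -!raddfB /=; congr (_%:M); ring.
have c0 : 1 - v 0 0 != 0.
  (* If the first entry of v is 1, then |w|^2 = 0, so v = e_0. *)
  apply: contra_neq nz => h; apply/eqP; rewrite -subr_eq0; apply/eqP.
  move: ww; rewrite h mulr0 => /matrixP/(_ 0 0); rewrite !mxE mul0rn => s0.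
  apply/matrixP=> i j; rewrite ord1 [RHS]mxE.
  have := psumr_eq0P _ s0 (i := i); rewrite !mxE => H.
  by apply/eqP; rewrite -sqrf_eq0 expr2 H // => k _; rewrite !mxE -expr2 sqr_ge0.
exists (1%:M - c *: (w *m w^T)).
  rewrite [X in X *m _](_ : _ = 1%:M - c *: (w *m w^T)); last first.
    by rewrite linearB /= trmx1 linearZ /= trmx_mul trmxK.
  set P := w *m w^T.
  have PP : P *m P = (2 * (1 - v 0 0)) *: P.
    by rewrite /P -mulmxA (mulmxA w^T) ww mul_scalar_mx -scalemxAr.
  rewrite mulmxBl mul1mx -scalemxAl mulmxBr mulmx1 -scalemxAr PP scalerBr !scalerA.
  have -> : c * c * (2 * (1 - v 0 0)) = c + c by rewrite /c; field.
  by rewrite scalerDl opprB addrK subrK.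
rewrite mulmxBl mul1mx -scalemxAl -mulmxA ew -/e.
by rewrite mul_mx_scalar scalerA /c -[v 0 0 - 1]opprB mulrN mulVf // scaleN1r opprK /w addrC subrK.
Qed.

(** Induction by deflation: in an orthonormal basis starting with an eigenvector, a symmetric A
    splits as a 1 x 1 block and a smaller symmetric block. *)
Lemma symmetric_spectral (R : rcfType) n (A : 'M[R]_n) : A^T = A ->
  exists2 Q : 'M[R]_n, Q^T *m Q = 1%:M & is_diag_mx (Q^T *m A *m Q).
Proof.
elim: n A => [|n IH] A sA.
  by exists 1%:M; [rewrite trmx1 mul1mx | apply/is_diag_mxP => -[]].
have [a /eigenvalueP[u ua u0]] := symmetric_eigenvalue sA.
pose s := \sum_k u 0 k ^+ 2.
have s0 : 0 < s.
  rewrite lt0r sumr_ge0 ?andbT; last by move=> k _; exact: sqr_ge0.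
  apply: contra_neq u0 => h; apply/rowP => k; rewrite mxE; apply/eqP.
  by rewrite -sqrf_eq0 (psumr_eq0P _ h) // => l _; exact: sqr_ge0.
pose v : 'cV[R]_n.+1 := (Num.sqrt s)^-1 *: u^T.
have vT : v^T = (Num.sqrt s)^-1 *: u by rewrite /v linearZ /= trmxK.
have vv : v^T *m v = 1%:M.
  rewrite vT -scalemxAl -scalemxAr scalerA -invfM -expr2 sqr_sqrtr ?ltW //.
  apply/matrixP=> i j; rewrite !ord1 !mxE eqxx.
  rewrite (_ : \sum_j _ = s) ?mulVf ?gt_eqF //.
  by apply: eq_bigr => k _; rewrite mxE expr2.
have Av : A *m v = a *: v.
  apply: trmx_inj; rewrite trmx_mul sA vT -scalemxAl ua.
  by rewrite [RHS]linearZ /= vT !scalerA mulrC.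
have [Q QQ Qe] := householder vv.
pose B : 'M[R]_n.+1 := Q^T *m A *m Q.
have sB : B^T = B by rewrite /B !trmx_mul trmxK sA mulmxA.
have Be : B *m (delta_mx 0 0 : 'cV[R]_n.+1) = a *: delta_mx 0 0.
  by rewrite /B -mulmxA Qe -mulmxA Av -scalemxAr -Qe mulmxA QQ mul1mx.
have Bk k : B k 0 = a * (k == 0)%:R.
  by have /matrixP/(_ k 0) := Be; rewrite -colE !mxE eqxx andbT.
(* Phrased through the value of the index, because block submatrices produce shifted ordinals that
   are not literally 0. *)
have Bkl (k l : 'I_n.+1) : l = 0 :> nat -> B k l = a * (k == 0 :> nat)%:R.
  by move=> l0; rewrite (_ : l = 0) ?Bk //; exact: val_inj.
have eB : Q^T *m (A *m Q) = B by rewrite mulmxA.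
clearbody B.
have sdr : (drsubmx (B : 'M[R]_(1 + n)))^T = drsubmx (B : 'M[R]_(1 + n)).
  by rewrite trmx_drsub sB.
have [Q' Q'Q' dQ'] := IH _ sdr.
have B0 : (B : 'M[R]_(1 + n)) = block_mx a%:M 0 0 (drsubmx (B : 'M[R]_(1 + n))).
  rewrite -{1}(submxK (B : 'M[R]_(1 + n))); congr block_mx.
  - by apply/matrixP=> i j; rewrite !ord1 !mxE Bkl // mulr1.
  - by apply/matrixP=> i j; rewrite !ord1 -{1}sB !mxE Bkl // mulr0.
  - by apply/matrixP=> i j; rewrite !ord1 !mxE Bkl // mulr0.
pose Q2 : 'M[R]_(1 + n) := block_mx 1%:M 0 0 Q'.
have Q2T : Q2^T = block_mx 1%:M 0 0 Q'^T by rewrite /Q2 tr_block_mx trmx1 !trmx0.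
have Q2Q2 : Q2^T *m Q2 = 1%:M.
  rewrite Q2T /Q2 mulmx_block.
  by rewrite !mulmx0 !mul0mx !mulmx1 !addr0 !add0r Q'Q' -scalar_mx_block.
have dB : is_diag_mx (Q2^T *m (B : 'M[R]_(1 + n)) *m Q2).
  rewrite B0 Q2T /Q2 !mulmx_block !(mulmx0, mul0mx, mulmx1, mul1mx, addr0, add0r).
  rewrite is_diag_block_mx //; apply/and4P; split=> //; exact: scalar_mx_is_diag.
exists (Q *m Q2).
  by rewrite trmx_mul mulmxA -(mulmxA _ Q^T) QQ mulmx1.
rewrite (_ : _ *m A *m _ = Q2^T *m B *m Q2) //.
by rewrite trmx_mul -eB !mulmxA.
Qed.

(** * Moreau decomposition *)

Section Projection.
Context {R : realType}.

Lemma frob2E k (A : 'M[R]_k) : symmx A -> frob2 A = \tr (A *m A).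
Proof.
move=> sA; rewrite /frob2 /mxtrace; apply: eq_bigr => i _; rewrite mxE.
by apply: eq_bigr => j _; rewrite -{3}sA mxE expr2.
Qed.

Lemma symmxB k (A B : 'M[R]_k) : symmx A -> symmx B -> symmx (A - B).
Proof. by rewrite /symmx linearB /= => -> ->. Qed.

Lemma symmxD k (A B : 'M[R]_k) : symmx A -> symmx B -> symmx (A + B).
Proof. by rewrite /symmx linearD /= => -> ->. Qed.

Lemma symmxZ k a (A : 'M[R]_k) : symmx A -> symmx (a *: A).
Proof. by rewrite /symmx linearZ /= => ->. Qed.

Lemma symmx_conj m k (G : 'M[R]_(k, m)) (A : 'M[R]_k) :
  symmx A -> symmx (G^T *m A *m G).
Proof. by rewrite /symmx !trmx_mul trmxK mulmxA => ->. Qed.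

Lemma symmx_diag k (A : 'M[R]_k) : is_diag_mx A -> symmx A.
Proof. by move=> /diag_mxP[d ->]; exact: tr_diag_mx. Qed.

Lemma symmxE k (A : 'M[R]_k) i j : symmx A -> A i j = A j i.
Proof. by move=> sA; rewrite -{1}sA mxE. Qed.

Lemma psdmx_conj m k (G : 'M[R]_(k, m)) (A : 'M[R]_k) :
  psdmx A -> psdmx (G^T *m A *m G).
Proof.
move=> [sA pA]; split; first exact: symmx_conj.
move=> v; have := pA (G *m v); rewrite trmx_mul !mulmxA; exact.
Qed.

Lemma psdmxZ k a (A : 'M[R]_k) : 0 <= a -> psdmx A -> psdmx (a *: A).
Proof.
move=> a0 [sA pA]; split; first exact: symmxZ.
by move=> v; rewrite -scalemxAr -scalemxAl mxE mulr_ge0.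
Qed.

Lemma psdmx_diag_ge0 k (A : 'M[R]_k) i : psdmx A -> 0 <= A i i.
Proof.
move=> [_ /(_ (delta_mx i 0))].
by rewrite trmx_delta -rowE -colE !mxE.
Qed.

Lemma psdmx_of_diag k (d : 'rV[R]_k) : (forall i, 0 <= d 0 i) -> psdmx (diag_mx d).
Proof.
move=> d0; split; first exact: tr_diag_mx.
move=> v; rewrite -mulmxA mxE sumr_ge0 // => i _; rewrite mul_diag_mx !mxE.
by rewrite mulrCA mulr_ge0 // -expr2 sqr_ge0.
Qed.

(** In a basis diagonalising A, the trace is a sum of products of diagonal entries of two PSD
    matrices. *)
Lemma psdmx_tr_ge0 k (A B : 'M[R]_k) : psdmx A -> psdmx B -> 0 <= \tr (A *m B).
Proof.
move=> pA pB; have [Q QQ dQ] := symmetric_spectral (proj1 pA).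
have QQ' := mulmx1C QQ.
have -> : \tr (A *m B) = \tr ((Q^T *m A *m Q) *m (Q^T *m B *m Q)).
  rewrite !mulmxA -(mulmxA (_ *m A)) QQ' mulmx1 [RHS]mxtrace_mulC !mulmxA.
  by rewrite QQ' mul1mx.
rewrite /mxtrace sumr_ge0 // => i _.
have := psdmx_diag_ge0 i (psdmx_conj Q pA); have /diag_mxP[d ->] := dQ.
rewrite mul_diag_mx !mxE eqxx mulr1n => d0; apply: mulr_ge0 => //.
have := psdmx_diag_ge0 i (psdmx_conj Q pB); rewrite mxE; exact.
Qed.

Lemma frob2_ge0 k (A : 'M[R]_k) : 0 <= frob2 A.
Proof. by apply: sumr_ge0 => i _; apply: sumr_ge0 => j _; exact: sqr_ge0. Qed.

Lemma sqr_entry_le_frob2 k (A : 'M[R]_k) i j : A i j ^+ 2 <= frob2 A.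
Proof.
rewrite /frob2 (bigD1 i) //= (bigD1 j) //= -addrA lerDl addr_ge0 //.
  by apply: sumr_ge0 => l _; exact: sqr_ge0.
by apply: sumr_ge0 => l _; apply: sumr_ge0 => ? _; exact: sqr_ge0.
Qed.

Lemma frob2_eq0 k (A : 'M[R]_k) : frob2 A <= 0 -> A = 0.
Proof.
move=> A0; apply/matrixP => i j; rewrite mxE; apply/eqP; rewrite -sqrf_eq0.
by rewrite eq_le sqr_ge0 andbT (le_trans (sqr_entry_le_frob2 _ _ _)).
Qed.

Lemma frob2B k (A B : 'M[R]_k) : symmx A -> symmx B ->
  frob2 (A - B) = frob2 A - 2 * \tr (A *m B) + frob2 B.
Proof.
move=> sA sB; rewrite !frob2E //; last exact: symmxB.
rewrite mulmxBl !mulmxBr !raddfB /= (mxtrace_mulC B A); ring.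
Qed.

(** Expanding |(P - X) - N|^2, the cross term is 2 tr(X N) >= 0 since P N = 0. The extra term |P -
    X|^2 yields uniqueness of the minimiser. *)
Lemma moreau_proj k (P N : 'M[R]_k) : psdmx P -> psdmx N -> P *m N = 0 ->
  forall X, psdmx X -> frob2 (P - N - P) + frob2 (P - X) <= frob2 (P - N - X).
Proof.
move=> pP pN PN X pX.
have -> : P - N - X = (P - X) - N by rewrite addrAC.
have -> : P - N - P = - N by rewrite addrAC subrr sub0r.
have -> : frob2 (- N) = frob2 N.
  by apply: eq_bigr => i _; apply: eq_bigr => j _; rewrite mxE sqrrN.
rewrite [leRHS]frob2B; [|exact: symmxB (proj1 pP) (proj1 pX)|exact: (proj1 pN)].
rewrite mulmxBl PN sub0r raddfN /=.
have := psdmx_tr_ge0 pX pN; lra.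
Qed.

Lemma Pi_plus_moreau k (P N : 'M[R]_k) : psdmx P -> psdmx N -> P *m N = 0 ->
  Pi_plus (P - N) = P.
Proof.
move=> pP pN PN; have H := moreau_proj pP pN PN.
have isP : is_proj_psd (P - N) P.
  by split=> // X pX; apply: le_trans (H X pX); rewrite lerDl frob2_ge0.
(* Since P is a minimiser, [xget] returns a minimiser and not its default 0. *)
have : is_proj_psd (P - N) (Pi_plus (P - N)).
  by apply: (@xgetPex _ 0 [set P' | is_proj_psd (P - N) P']); exists P.
move: (Pi_plus _) => X [pX minX].
have := minX P pP; have := H X pX => h1 h2.
have : frob2 (P - X) <= 0 by lra.
by move=> /frob2_eq0/eqP; rewrite subr_eq0 => /eqP ->.
Qed.

(** P and N carry the positive and negative parts of the spectrum in a common eigenbasis. *)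
Lemma moreau_exists k (Z : 'M[R]_k) : symmx Z ->
  exists P N : 'M[R]_k, [/\ psdmx P, psdmx N, Z = P - N & P *m N = 0].
Proof.
move=> sZ; have [Q QQ /diag_mxP[d dE]] := symmetric_spectral sZ.
have QQ' := mulmx1C QQ.
pose dp := \row_j Num.max (d 0 j) 0; pose dn := \row_j Num.max (- d 0 j) 0.
have pdp : psdmx (diag_mx dp).
  by apply: psdmx_of_diag => i; rewrite mxE le_max lexx orbT.
have pdn : psdmx (diag_mx dn).
  by apply: psdmx_of_diag => i; rewrite mxE le_max lexx orbT.
have conjE (D : 'M[R]_k) : Q *m D *m Q^T = (Q^T)^T *m D *m Q^T by rewrite trmxK.
exists (Q *m diag_mx dp *m Q^T), (Q *m diag_mx dn *m Q^T); split.
- by rewrite conjE; exact: psdmx_conj.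
- by rewrite conjE; exact: psdmx_conj.
- rewrite -mulmxBl -mulmxBr -raddfB /=.
  rewrite (_ : dp - dn = d).
    by rewrite -dE !mulmxA QQ' mul1mx -mulmxA QQ' mulmx1.
  apply/rowP => j; rewrite !mxE; case: (leP (d 0 j) 0) => dj.
    by rewrite max_l ?oppr_ge0 // sub0r opprK.
  by rewrite max_r ?subr0 // oppr_le0 ltW.
- rewrite !mulmxA -(mulmxA _ Q^T) QQ mulmx1 -(mulmxA Q).
  rewrite (_ : diag_mx dp *m diag_mx dn = 0) ?mulmx0 ?mul0mx //.
  rewrite mul_diag_mx; apply/matrixP => i j; rewrite !mxE.
  case: (eqVneq i j) => [->|]; last by rewrite mulr0n mulr0.
  rewrite mulr1n; case: (leP (d 0 j) 0) => dj; first by rewrite mul0r.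
  by rewrite max_r ?mulr0 // oppr_le0 ltW.
Qed.

Lemma Pi_plusP k (Z : 'M[R]_k) : symmx Z ->
  [/\ psdmx (Pi_plus Z), psdmx (Pi_plus Z - Z),
      Pi_plus Z *m (Pi_plus Z - Z) = 0 & (Pi_plus Z - Z) *m Pi_plus Z = 0].
Proof.
move=> /moreau_exists[P [N [pP pN ZE PN]]].
have -> : Pi_plus Z = P by rewrite ZE Pi_plus_moreau.
have -> : P - Z = N by rewrite ZE opprB addrC subrK.
by split=> //; rewrite -(proj1 pN) -(proj1 pP) -trmx_mul PN trmx0.
Qed.

Lemma Pi_plus_sym k (Z : 'M[R]_k) : symmx Z -> symmx (Pi_plus Z).
Proof. by move=> /Pi_plusP[[]]. Qed.

Lemma Pi_plus_eq k (Z P : 'M[R]_k) : psdmx P -> psdmx (P - Z) ->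
  P *m (P - Z) = 0 -> Pi_plus Z = P.
Proof. by move=> pP pN /(Pi_plus_moreau pP pN); rewrite opprB addrC subrK. Qed.

Lemma Pi_plusN k (Z : 'M[R]_k) : symmx Z -> Pi_plus (- Z) = Pi_plus Z - Z.
Proof.
move=> sZ; have [pP pN PN NP] := Pi_plusP sZ.
by apply: Pi_plus_eq; rewrite // opprK subrK.
Qed.

Lemma Pi_plusZ k (Z : 'M[R]_k) t : 0 <= t -> symmx Z ->
  Pi_plus (t *: Z) = t *: Pi_plus Z.
Proof.
move=> t0 sZ; have [pP pN PN NP] := Pi_plusP sZ.
apply: Pi_plus_eq; rewrite -?scalerBr; try exact: psdmxZ.
by rewrite -scalemxAl -scalemxAr PN !scaler0.
Qed.

Lemma Pi_plus_conj k (Z Q : 'M[R]_k) : Q^T *m Q = 1%:M -> symmx Z ->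
  Pi_plus (Q^T *m Z *m Q) = Q^T *m Pi_plus Z *m Q.
Proof.
move=> QQ sZ; have [pP pN PN NP] := Pi_plusP sZ.
have QQ' := mulmx1C QQ.
apply: Pi_plus_eq; rewrite -?mulmxBl -?mulmxBr; try exact: psdmx_conj.
by rewrite !mulmxA -(mulmxA _ Q) QQ' mulmx1 -(mulmxA Q^T) PN mulmx0 mul0mx.
Qed.

Lemma Pi_plus_diag k (Z : 'M[R]_k) : is_diag_mx Z ->
  Pi_plus Z = diag_mx (\row_i Num.max (Z i i) 0).
Proof.
move=> /diag_mxP[d ->]; apply: Pi_plus_eq.
- by apply: psdmx_of_diag => i; rewrite mxE le_max lexx orbT.
- rewrite -raddfB /=; apply: psdmx_of_diag => i.
  by rewrite !mxE eqxx mulr1n subr_ge0 le_max lexx.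
- rewrite -raddfB /= mul_diag_mx; apply/matrixP => i j; rewrite !mxE.
  case: (eqVneq i j) => [->|]; last by rewrite mulr0n mulr0.
  rewrite !mulr1n eqxx mulr1n; case: (leP (d 0 j) 0) => dj; first by rewrite mul0r.
  by rewrite subrr mulr0.
Qed.

(** Write A - B = (P - P') - (N - N'). The cross term of the squared norm equals 2 tr(P N') + 2
    tr(P' N), which is nonnegative. *)
Lemma Pi_plus_nonexp k (A B : 'M[R]_k) : symmx A -> symmx B ->
  frob2 (Pi_plus A - Pi_plus B) <= frob2 (A - B).
Proof.
move=> sA sB; have [pP pN PN NP] := Pi_plusP sA.
have [pP' pN' PN' NP'] := Pi_plusP sB.
set P := Pi_plus A in pP pN PN NP *; set P' := Pi_plus B in pP' pN' PN' NP' *.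
set N := P - A in pN PN NP; set N' := P' - B in pN' PN' NP'.
have -> : A - B = (P - P') - (N - N') by apply/matrixP => i j; rewrite !mxE; ring.
clearbody N N'; rewrite [leRHS]frob2B;
  [|exact: symmxB (proj1 pP) (proj1 pP')|exact: symmxB (proj1 pN) (proj1 pN')].
rewrite mulmxBl !mulmxBr PN PN' sub0r subr0 !raddfB raddfN /=.
have := psdmx_tr_ge0 pP pN'; have := psdmx_tr_ge0 pP' pN.
have := frob2_ge0 (N - N'); lra.
Qed.

(** With A = Q diag(d) Q^T and L = Q^T K, each diagonal entry of K^T A K is a sum of terms d_i
    L_ij^2 >= 0, so all of them vanish and diag(d) L = 0. *)
Lemma psdmx_ker k m (A : 'M[R]_k) (K : 'M[R]_(k, m)) : psdmx A ->
  K^T *m A *m K = 0 -> A *m K = 0.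
Proof.
move=> pA; have [Q QQ /diag_mxP[d dE]] := symmetric_spectral (proj1 pA).
have QQ' := mulmx1C QQ.
have d0 i : 0 <= d 0 i.
  by have := psdmx_diag_ge0 i (psdmx_conj Q pA); rewrite dE !mxE eqxx.
have AE : A = Q *m diag_mx d *m Q^T.
  by rewrite -dE !mulmxA QQ' mul1mx -mulmxA QQ' mulmx1.
move=> h; suff h0 : diag_mx d *m (Q^T *m K) = 0.
  by rewrite AE -!mulmxA h0 mulmx0.
move: h; rewrite AE; set L := Q^T *m K => h.
have {}h : L^T *m (diag_mx d *m L) = 0 by rewrite -h /L trmx_mul trmxK !mulmxA.
clearbody L; apply/matrixP => i j; have /matrixP/(_ j j) := h; rewrite mul_diag_mx !mxE => /psumr_eq0P H.
have {}H : d 0 i * L i j ^+ 2 = 0.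
  have := H _ i isT; rewrite !mxE mulrCA -expr2; apply.
  by move=> l _; rewrite !mxE mulrCA -expr2 mulr_ge0 // sqr_ge0.
by apply/eqP; rewrite mulf_eq0 -(sqrf_eq0 (L i j)) -mulf_eq0 H.
Qed.

End Projection.

(** * Order of vanishing at 0+ *)

Section BigO.
Context {R : realType}.
Implicit Types (f g : R -> R) (k l : nat).

Definition bigo k f := exists C : R, \forall t \near 0^'+, `|f t| <= C * t ^+ k.

Lemma near_pos : \forall t \near (0 : R)^'+, 0 < t.
Proof. exact: nbhs_right_gt. Qed.

Lemma near_lt (e : R) : 0 < e -> \forall t \near (0 : R)^'+, t < e.
Proof. by move=> e0; apply: nbhs_right_lt. Qed.

Lemma bigo_near k f g : (\forall t \near 0^'+, f t = g t) -> bigo k f -> bigo k g.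
Proof.
move=> fg [C fC]; exists C; apply: filterS2 fg fC => t -> //.
Qed.

Lemma bigo_eq k f g : (forall t, f t = g t) -> bigo k f -> bigo k g.
Proof. by move=> /funext ->. Qed.

Lemma bigo_ge0 k f : bigo k f ->
  exists2 C : R, 0 <= C & \forall t \near 0^'+, `|f t| <= C * t ^+ k.
Proof.
move=> [C fC]; exists `|C| => //; apply: filterS2 near_pos fC => t t0.
by move=> /le_trans; apply; rewrite ler_wpM2r ?exprn_ge0 ?ler_norm // ltW.
Qed.

Lemma bigoD k f g : bigo k f -> bigo k g -> bigo k (fun t => f t + g t).
Proof.
move=> [C fC] [D gD]; exists (C + D); apply: filterS2 fC gD => t h1 h2.
by rewrite mulrDl (le_trans (ler_normD _ _)) // lerD.
Qed.

Lemma bigoN k f : bigo k f -> bigo k (fun t => - f t).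
Proof. by move=> [C fC]; exists C; apply: filterS fC => t; rewrite normrN. Qed.

Lemma bigoB k f g : bigo k f -> bigo k g -> bigo k (fun t => f t - g t).
Proof. by move=> fk /bigoN; exact: bigoD. Qed.

Lemma bigoM k l f g : bigo k f -> bigo l g -> bigo (k + l) (fun t => f t * g t).
Proof.
move=> [C fC] [D gD]; exists (C * D); apply: filterS2 fC gD => t h1 h2.
by rewrite normrM exprD mulrACA ler_pM.
Qed.

Lemma bigo_cst c : bigo 0 (fun=> c).
Proof. by exists `|c|; apply: filterE => t; rewrite expr0 mulr1. Qed.

Lemma bigoZ k c f : bigo k f -> bigo k (fun t => c * f t).
Proof. by move=> /(bigoM (bigo_cst c)). Qed.

Lemma bigo_pow k : bigo k (fun t => t ^+ k).
Proof.
by exists 1; apply: filterS near_pos => t t0; rewrite mul1r ger0_norm // exprn_ge0 // ltW.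
Qed.

Lemma bigo0 k : bigo k (fun=> 0).
Proof. by exists 0; apply: filterE => t; rewrite normr0 mul0r. Qed.

Lemma bigo_sum k (I : Type) (r : seq I) (Q : pred I) (F : I -> R -> R) :
  (forall i, Q i -> bigo k (F i)) -> bigo k (fun t => \sum_(i <- r | Q i) F i t).
Proof.
move=> FO; elim: r => [|i r IH].
  by apply: bigo_eq (bigo0 k) => t; rewrite big_nil.
case Qi : (Q i).
  by apply: bigo_eq (bigoD (FO i Qi) IH) => t; rewrite big_cons Qi.
by apply: bigo_eq IH => t; rewrite big_cons Qi.
Qed.

Lemma bigo_le k l f : (l <= k)%N -> bigo k f -> bigo l f.
Proof.
move=> lk /bigo_ge0[C C0 fC]; exists C.
apply: filterS3 near_pos (near_lt ltr01) fC => t t0 t1 /le_trans; apply.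
by rewrite ler_wpM2l // ler_wiXn2l // ltW.
Qed.

Lemma bigo_norm k f : bigo k f -> bigo k (fun t => `|f t|).
Proof. by move=> [C fC]; exists C; apply: filterS fC => t; rewrite normr_id. Qed.

Lemma bigo_dom k f g : (\forall t \near 0^'+, `|f t| <= g t) -> bigo k g -> bigo k f.
Proof.
move=> fg [C gC]; exists C; apply: filterS2 fg gC => t h1.
by apply: le_trans; apply: le_trans h1 (ler_norm _).
Qed.

Lemma bigo_sqr k f : bigo (k * 2) (fun t => f t ^+ 2) -> bigo k f.
Proof.
(* C <= (C + 1)^2, so no square root of C is needed. *)
move=> /bigo_ge0[C C0 fC]; exists (C + 1).
apply: filterS2 near_pos fC => t t0 h.
have t0k : 0 <= t ^+ k by rewrite exprn_ge0 // ltW.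
rewrite -(@ler_pXn2r _ 2) ?nnegrE ?mulr_ge0 ?addr_ge0 //.
rewrite exprMn -exprM -normrX; apply: le_trans h _.
by rewrite ler_wpM2r ?exprn_ge0 ?(ltW t0) //; nra.
Qed.

Lemma bigo_powM k l f : bigo (k + l) (fun t => t ^+ k * f t) -> bigo l f.
Proof.
move=> [C fC]; exists C; apply: filterS2 near_pos fC => t t0.
have tk : 0 < t ^+ k by exact: exprn_gt0.
by rewrite normrM exprD mulrCA (gtr0_norm tk) ler_pM2l.
Qed.

(** On the zero block the step along V_0 is t/2, once a factor t has been taken out. *)
Lemma bigo_half k f : bigo k f -> bigo k (fun t => f (t / 2)).
Proof.
move=> /bigo_ge0[C C0]; rewrite near_withinE => /nbhs_ballP[e /= e0 fC]; exists C.
apply: filterS2 near_pos (near_lt e0) => t t0 te.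
have t2 : 0 < t / 2 by rewrite divr_gt0.
have t2t : t / 2 <= t by lra.
apply: le_trans (fC _ _ t2) _.
  by rewrite -ball_normE /= sub0r normrN gtr0_norm //; lra.
by rewrite ler_wpM2l // lerXn2r ?nnegrE // ltW.
Qed.

Lemma bigo_cvg0 f : bigo 1 f -> f @ 0^'+ --> (0 : R).
Proof.
move=> /bigo_ge0[C C0 fC]; apply/cvgr0Pnorm_lt => e e0.
have d0 : 0 < e / (C + 1) by rewrite divr_gt0 // ltr_wpDl.
apply: filterS3 near_pos (near_lt d0) fC => t t0.
rewrite ltr_pdivlMr ?ltr_wpDl // => te /le_lt_trans; apply.
by rewrite expr1; nra.
Qed.

(** Gives uniqueness of expansion coefficients, from which their symmetry is deduced. *)
Lemma bigo_cst_eq0 c : bigo 1 (fun=> c) -> c = 0.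
Proof.
move=> /bigo_cvg0 h; have := cvg_unique _ h (cvg_cst c).
by move=> /(_ (@Rhausdorff R)) <-.
Qed.

(* The terms c i j * b j are absorbed in the left-hand side, as c i j tends to
   0; no a priori bound on b is needed. *)
Lemma bigo_absorb k (I : finType) (a b : I -> R -> R) (c : I -> I -> R -> R) :
  (forall i, bigo k (a i)) -> (forall i j, bigo 1 (c i j)) ->
  (forall i t, b i t = a i t + \sum_j c i j t * b j t) ->
  forall i, bigo k (b i).
Proof.
move=> aO cO bE i.
pose S t := \sum_i `|b i t|; pose al t := \sum_i `|a i t|.
pose ka t := \sum_i \sum_j `|c i j t|.
have alO : bigo k al by apply: bigo_sum => j _; exact: bigo_norm.
have [C C0 kaC] : exists2 C : R, 0 <= C & \forall t \near 0^'+, `|ka t| <= C * t ^+ 1.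
  by apply/bigo_ge0/bigo_sum => j _; apply: bigo_sum => l _; exact: bigo_norm.
have Sle t : S t <= al t + ka t * S t.
  rewrite /S /al /ka mulr_suml -big_split /=; apply: ler_sum => j _.
  rewrite [in leLHS]bE (le_trans (ler_normD _ _)) // lerD2l.
  rewrite (le_trans (ler_norm_sum _ _ _)) // mulr_suml; apply: ler_sum => l _.
  rewrite normrM ler_wpM2l // (bigD1 l) //= lerDl; exact: sumr_ge0.
apply: (@bigo_dom _ _ (fun t => 2 * al t)); last exact: bigoZ.
(* Below this threshold [ka t] is at most 1/2, so [Sle] gives [S t <= 2 * al t]. *)
have d0 : 0 < (2 * (C + 1))^-1 by rewrite invr_gt0 mulr_gt0 // ltr_wpDl.
apply: filterS3 near_pos (near_lt d0) kaC => t t0.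
rewrite -div1r ltr_pdivlMr ?mulr_gt0 ?ltr_wpDl // => td kat.
have bS : `|b i t| <= S t by rewrite /S (bigD1 i) //= lerDl; exact: sumr_ge0.
have ka2 : ka t <= 2^-1.
  by apply: le_trans (ler_norm _) _; apply: le_trans kat _; rewrite expr1; nra.
have S0 : 0 <= S t by exact: sumr_ge0.
apply: le_trans bS _; have := Sle t; nra.
Qed.

Lemma bigo_mx_cvg m n (F : R -> 'M[R]_(m, n)) (L : 'M[R]_(m, n)) :
  (forall i j, bigo 1 (fun t => F t i j - L i j)) -> F @ 0^'+ --> L.
Proof.
move=> FL; apply/cvg_ballP => e e0.
have H ij : \forall t \near (0 : R)^'+, ball (L ij.1 ij.2) e (F t ij.1 ij.2).
  have /cvgr0Pnorm_lt/(_ _ e0) := bigo_cvg0 (FL ij.1 ij.2).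
  by apply: filterS => t; rewrite -ball_normE /= distrC.
have {}H : \forall t \near (0 : R)^'+, forall ij : 'I_m * 'I_n,
    ball (L ij.1 ij.2) e (F t ij.1 ij.2) by exact: filter_forall.
by near=> t; split=> // i j; apply: (near H t _ (i, j)).
Unshelve. all: by end_near.
Qed.

End BigO.

(** * Schur complements and off-zero blocks *)

Section SchurCorrection.
Context {R : realType}.

(* As P is PSD, J P J K = 0 forces P J K = 0, so the correction B exists even
   when the block J P J is singular. *)
Lemma psdmx_schur_solvable n m (P J : 'M[R]_n) (E : 'M[R]_(n, m)) :
  psdmx P -> symmx J -> J *m J = J ->
  exists B : 'M[R]_(n, m), J *m B = B /\ J *m P *m (E + B) = 0.
Proof.
move=> pP sJ JJ; have sP := proj1 pP.
pose X := J *m P *m J; pose Y := E^T *m P *m J.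
have YX : (Y <= X)%MS.
  rewrite submxE; apply/eqP; set K := cokermx X.
  have XK : X *m K = 0 by exact: mulmx_coker.
  rewrite /Y -!mulmxA psdmx_ker ?mulmx0 //.
  by rewrite trmx_mul sJ -!mulmxA (mulmxA J) (mulmxA _ J) -/X XK mulmx0.
pose D := Y *m pinvmx X.
have DX : D *m X = Y by rewrite mulmxKpV.
have XT : X^T = X by rewrite /X !trmx_mul sJ sP mulmxA.
have YT : Y^T = J *m P *m E by rewrite /Y !trmx_mul trmxK sJ sP mulmxA.
exists (- (J *m D^T)); split; first by rewrite mulmxN mulmxA JJ.
rewrite mulmxDr mulmxN mulmxA -/X -YT -DX trmx_mul XT; exact: subrr.
Qed.

(* With G = E + B, the matrix G^T P G is the Schur complement of P relative to
   the range of Jp, since Jp P G = 0; likewise for N, C and Jm. *)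
Lemma Pi_plus_schur n m (P N Jp Jm : 'M[R]_n) (E B C : 'M[R]_(n, m)) :
  psdmx P -> psdmx N -> P *m N = 0 -> symmx Jp -> symmx Jm ->
  E *m E^T = 1%:M - Jp - Jm ->
  Jp *m B = B -> Jp *m P *m (E + B) = 0 ->
  Jm *m C = C -> Jm *m N *m (E + C) = 0 ->
  Pi_plus (E^T *m (P - N) *m E + E^T *m P *m B - E^T *m N *m C) =
    E^T *m P *m E + E^T *m P *m B.
Proof.
move=> pP pN PN sJp sJm EE JB PB JC NC.
have gramE (M J : 'M[R]_n) (F : 'M[R]_(n, m)) : symmx J -> J *m F = F ->
    J *m M *m (E + F) = 0 -> (E + F)^T *m M *m (E + F) = E^T *m M *m (E + F).
  move=> sJ JF h; have -> : (E + F)^T = E^T + F^T by rewrite linearD.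
  rewrite 2!mulmxDl -[X in _ + X = _]addr0.
  rewrite (_ : F^T *m M *m (E + F) = 0) ?addr0 //.
  by rewrite -{1}JF trmx_mul sJ -!mulmxA (mulmxA J) h mulmx0.
have PE := gramE P _ _ sJp JB PB; have NE := gramE N _ _ sJm JC NC.
have hP : E^T *m P *m E + E^T *m P *m B = (E + B)^T *m P *m (E + B).
  by rewrite PE mulmxDr.
have hN : E^T *m N *m E + E^T *m N *m C = (E + C)^T *m N *m (E + C).
  by rewrite NE mulmxDr.
have dE : E^T *m P *m E + E^T *m P *m B
    - (E^T *m (P - N) *m E + E^T *m P *m B - E^T *m N *m C) =
    (E + C)^T *m N *m (E + C).
  by rewrite -hN mulmxBr mulmxBl; apply/matrixP => i j; rewrite !mxE; ring.
apply: Pi_plus_eq; rewrite ?dE ?hP; try exact: psdmx_conj.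
rewrite NE.
have -> : (E + B)^T *m P *m (E + B) = (E + B)^T *m P *m E.
  have := congr1 trmx PE; rewrite !trmx_mul !trmxK (proj1 pP) !mulmxA; exact.
have PJ : (E + B)^T *m P *m Jp = 0.
  by have := congr1 trmx PB; rewrite !trmx_mul sJp (proj1 pP) trmx0 mulmxA.
(* Between the two complements stands E E^T = 1 - Jp - Jm: the identity contributes P N = 0, while
   Jp and Jm are killed by the equations defining B and C. *)
rewrite !mulmxA -(mulmxA _ E) EE !(mulmxBr, mulmx1, mulmxBl) PJ !mul0mx subr0.
rewrite -(mulmxA _ P N) PN mulmx0 mul0mx sub0r.
by rewrite -!mulmxA (mulmxA Jm) NC !mulmx0 oppr0.
Qed.

End SchurCorrection.

(** Nonexpansiveness bounds the square of each entry by [frob2 (A t - B t)], which is O(t^(2k)). *)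
Lemma Pi_plus_bigo (R : realType) k m (A B : R -> 'M[R]_m) :
  (forall t, symmx (A t)) -> (forall t, symmx (B t)) ->
  (forall i j, bigo k (fun t => A t i j - B t i j)) ->
  forall i j, bigo k (fun t => Pi_plus (A t) i j - Pi_plus (B t) i j).
Proof.
move=> sA sB AB i j; apply: bigo_sqr.
apply: (@bigo_dom _ _ _ (fun t => frob2 (A t - B t))).
  apply: filterE => t; rewrite ger0_norm ?sqr_ge0 //.
  apply: le_trans (Pi_plus_nonexp (sA t) (sB t)).
  by have := sqr_entry_le_frob2 (Pi_plus (A t) - Pi_plus (B t)) i j; rewrite !mxE.
apply: bigo_sum => p _; apply: bigo_sum => q _.
rewrite muln2 -addnn; apply: bigo_eq (bigoM (AB p q) (AB p q)) => t.
by rewrite !mxE expr2.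
Qed.

(** * Deviations of the two Moreau parts along the curve *)

Section Expansion.
Context {R : realType} {n : nat}.
Implicit Types Z H W : 'M[R]_n.

(** [zpos] and [zneg] are the diagonals of Z_+ and Z_- when Z is diagonal. *)
Definition zpos Z i : R := Num.max (Z i i) 0.
Definition zneg Z i : R := Num.max (- Z i i) 0.

Lemma zpos_gt0 Z i : 0 < Z i i -> (zpos Z i = Z i i) * (zneg Z i = 0).
Proof. by move=> z; rewrite /zpos /zneg max_l ?max_r // ?oppr_le0 ltW. Qed.

Lemma zpos_lt0 Z i : Z i i < 0 -> (zpos Z i = 0) * (zneg Z i = - Z i i).
Proof. by move=> z; rewrite /zpos /zneg max_r ?max_l // ?oppr_ge0 ltW. Qed.

Lemma zpos_eq0 Z i : Z i i = 0 -> (zpos Z i = 0) * (zneg Z i = 0).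
Proof. by move=> z; rewrite /zpos /zneg z oppr0 maxxx. Qed.

Lemma zpos_zneg Z i : zpos Z i - zneg Z i = Z i i.
Proof.
have [z|z|z] := ltrgt0P (Z i i); first by rewrite !(zpos_gt0 z) subr0.
  by rewrite !(zpos_lt0 z) sub0r opprK.
by rewrite !(zpos_eq0 z) z subr0.
Qed.

Lemma zposM Z i : zpos Z i * zneg Z i = 0.
Proof.
have [z|z|z] := ltrgt0P (Z i i); first by rewrite !(zpos_gt0 z) mulr0.
  by rewrite !(zpos_lt0 z) mul0r.
by rewrite !(zpos_eq0 z) mulr0.
Qed.

Definition curve Z H W t := Z + t *: H + ((t ^+ 2) / 2) *: W.

Lemma curve_sym Z H W t : is_diag_mx Z -> symmx H -> symmx W -> symmx (curve Z H W t).
Proof.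
by move=> dZ sH sW; apply: symmxD; [apply: symmxD; [exact: symmx_diag|]|]; exact: symmxZ.
Qed.

Definition pdev Z H W t := Pi_plus (curve Z H W t) - Pi_plus Z.
(** The deviation q = N - Z_-, since N = P - A. *)
Definition ndev Z H W t := pdev Z H W t - (t *: H + ((t ^+ 2) / 2) *: W).

Section Deviation.
Context (Z H W : 'M[R]_n) (dZ : is_diag_mx Z) (sH : symmx H) (sW : symmx W).
Notation p := (pdev Z H W).
Notation q := (ndev Z H W).

Lemma pdev_sym t i j : p t i j = p t j i.
Proof.
apply: symmxE; apply: symmxB; first exact/Pi_plus_sym/curve_sym.
exact/Pi_plus_sym/symmx_diag.
Qed.

Lemma ndevE t i j : q t i j = p t i j - (t * H i j + t ^+ 2 / 2 * W i j).
Proof. by rewrite /ndev !mxE. Qed.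

Lemma quadO (c : R) : bigo 2 (fun t => t ^+ 2 / 2 * c).
Proof. by apply: bigo_eq (bigoZ (c / 2) (bigo_pow 2)) => t; ring. Qed.

Lemma linO (c : R) : bigo 1 (fun t => t * c).
Proof. by apply: bigo_eq (bigoZ c (bigo_pow 1)) => t; ring. Qed.

Lemma pdevO i j : bigo 1 (fun t => p t i j).
Proof.
have sZ := symmx_diag dZ.
have := @Pi_plus_bigo _ 1 _ (curve Z H W) (fun=> Z) (fun t => curve_sym t dZ sH sW)
  (fun=> sZ) _ i j.
have h k l : bigo 1 (fun t => curve Z H W t k l - Z k l).
  apply: bigo_eq (bigoD (linO (H k l)) (bigo_le (isT : (1 <= 2)%N) (quadO (W k l)))) => t.
  by rewrite /curve !mxE; ring.
by move=> /(_ h); apply: bigo_eq => t; rewrite /pdev !mxE.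
Qed.

Lemma ndevO1 i j : bigo 1 (fun t => q t i j).
Proof.
apply: (@bigo_eq _ _ (fun t => p t i j - (t * H i j + t ^+ 2 / 2 * W i j))).
  by move=> t; rewrite ndevE.
apply: bigoB; first exact: pdevO.
by apply: bigoD; [exact: linO | apply: bigo_le (quadO _)].
Qed.

Lemma Pi_plus_entry t i j : Pi_plus (curve Z H W t) i j = p t i j + zpos Z i *+ (i == j).
Proof.
rewrite /pdev !mxE (Pi_plus_diag dZ) !mxE /zpos subrK //.
Qed.

Lemma Pi_plusN_entry t i j :
  (Pi_plus (curve Z H W t) - curve Z H W t) i j = q t i j + zneg Z i *+ (i == j).
Proof.
rewrite mxE Pi_plus_entry ndevE /curve !mxE.
case: eqVneq => [->|ij]; first by rewrite !mulr1n -[Z j j]zpos_zneg; ring.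
by have /is_diag_mxP/(_ i j) -> := dZ; rewrite ?mulr0n // !addr0 add0r.
Qed.

Lemma pdev_ndev t i j :
  zpos Z i * q t i j + p t i j * zneg Z j + \sum_k p t i k * q t k j = 0.
Proof.
have [_ _ /matrixP/(_ i j) + _] := Pi_plusP (curve_sym t dZ sH sW).
rewrite mxE [RHS]mxE => h; rewrite -[RHS]h.
(* The product of the two diagonal entries is left out, being 0 by [zposM]. *)
rewrite [RHS](eq_bigr (fun k => p t i k * q t k j
    + ((if k == i then zpos Z i * q t i j else 0)
    + (if k == j then p t i j * zneg Z j else 0)))).
  rewrite !big_split /= -!big_mkcond !big_pred1_eq; ring.
move=> k _; rewrite Pi_plus_entry Pi_plusN_entry (eq_sym i k).
case: (eqVneq k i) => [->|ki]; case: (eqVneq _ j) => [->|kj]; rewrite ?mulr1n ?mulr0n.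
- rewrite -[RHS]addr0 -(zposM Z j); ring.
- ring.
- ring.
- ring.
Qed.

(* The pairs (i, j) for which pdev_ndev can be solved for pdev; the others
   belong to the zero block, up to exchanging i and j. *)
Definition pivot i j := zpos Z i + zneg Z j != 0.

Lemma pdev_pivot t i j : pivot i j ->
  p t i j = (zpos Z i * (t * H i j + t ^+ 2 / 2 * W i j)
             - \sum_k p t i k * q t k j) / (zpos Z i + zneg Z j).
Proof.
move=> g; have := pdev_ndev t i j; rewrite ndevE => h.
apply: (canRL (mulfK g)); apply/eqP; rewrite -subr_eq0; apply/eqP.
by rewrite -[RHS]h; ring.
Qed.

(** The products p_ik q_kj are O(t^2), so only the linear term in H survives at first order. *)
Lemma pdev_pivot1 i j : pivot i j ->
  bigo 2 (fun t => p t i j - t * (zpos Z i / (zpos Z i + zneg Z j) * H i j)).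
Proof.
move=> g; apply: (@bigo_eq _ _ (fun t => (zpos Z i + zneg Z j)^-1 *
   (zpos Z i * (t ^+ 2 / 2 * W i j) - \sum_k p t i k * q t k j))).
  by move=> t; rewrite pdev_pivot //; ring.
apply: bigoZ; apply: bigoB; first exact/bigoZ/quadO.
by apply: bigo_sum => k _; exact: bigoM (pdevO i k) (ndevO1 k j).
Qed.

Lemma pdev_pos i j : 0 < Z i i -> ~~ (Z j j < 0) -> bigo 2 (fun t => p t i j - t * H i j).
Proof.
move=> zi zj; have zmj : zneg Z j = 0.
  have [z|z|z] := ltrgt0P (Z j j); [by rewrite (zpos_gt0 z)| by rewrite z in zj|].
  by rewrite (zpos_eq0 z).
have g : pivot i j by rewrite /pivot (zpos_gt0 zi) zmj addr0 gt_eqF.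
apply: bigo_eq (pdev_pivot1 g) => t.
by rewrite zmj addr0 (zpos_gt0 zi) divff ?mul1r // gt_eqF.
Qed.

End Deviation.
End Expansion.

(** * The zero block *)

Section ZeroBlock.
Context {R : realType} {n m : nat} (e : 'I_m -> 'I_n).
Implicit Types Z H W : 'M[R]_n.

(* Right (left) multiplication by selmx (its transpose) selects the columns
   (rows) listed by e. *)
Definition selmx : 'M[R]_(n, m) := \matrix_(i, s) (i == e s)%:R.
Notation E := selmx.

Lemma mulmx_selr k (M : 'M[R]_(k, n)) i s : (M *m E) i s = M i (e s).
Proof.
rewrite mxE (bigD1 (e s)) //= mxE eqxx mulr1 big1 ?addr0 // => j js.
by rewrite mxE (negPf js) mulr0.
Qed.

Lemma mulmx_sell k (M : 'M[R]_(n, k)) r j : (E^T *m M) r j = M (e r) j.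
Proof.
rewrite mxE (bigD1 (e r)) //= !mxE eqxx mul1r big1 ?addr0 // => i ir.
by rewrite !mxE (negPf ir) mul0r.
Qed.

Definition posmx Z : 'M[R]_n := diag_mx (\row_i (0 < Z i i)%R%:R).

Lemma posmx_sym Z : symmx (posmx Z).
Proof. exact: tr_diag_mx. Qed.

Lemma posmx_idem Z : posmx Z *m posmx Z = posmx Z.
Proof.
rewrite /posmx mul_diag_mx; apply/matrixP => i j; rewrite !mxE.
by case: (0 < _); rewrite ?mul1r ?mul0r ?mul0rn.
Qed.

Lemma mul_posmx Z k (M : 'M[R]_(n, k)) i j :
  (posmx Z *m M) i j = if 0 < Z i i then M i j else 0.
Proof. by rewrite /posmx mul_diag_mx !mxE; case: ifP; rewrite ?mul1r ?mul0r. Qed.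

Lemma curveN Z H W t : curve (- Z) (- H) (- W) t = - curve Z H W t.
Proof. by rewrite /curve !scalerN !opprD. Qed.

(** Row i of the equation for B reads Z_ii B_is = - p_is - sum_k p_ik B_ks. Hence B is O(t) by
    absorption, then B_is = - t H_is / Z_ii + O(t^2), and this is multiplied by p_ri = t H_ri +
    O(t^2). *)
Lemma schur_corr_expand Z H W (B : R -> 'M[R]_(n, m)) :
  is_diag_mx Z -> symmx H -> symmx W -> (forall s, Z (e s) (e s) = 0) ->
  (forall t, posmx Z *m B t = B t) ->
  (forall t, posmx Z *m Pi_plus (curve Z H W t) *m (E + B t) = 0) ->
  forall r s, bigo 3 (fun t => (E^T *m Pi_plus (curve Z H W t) *m B t) r s
    + t ^+ 2 * \sum_(i | 0 < Z i i) (Z i i)^-1 * H (e r) i * H i (e s)).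
Proof.
move=> dZ sH sW Ze JB PB r s; set p := pdev Z H W.
have B0 t i : ~~ (0 < Z i i) -> B t i s = 0.
  by move=> zi; rewrite -JB mul_posmx (negPf zi).
have BE t i : 0 < Z i i ->
    B t i s = - (Z i i)^-1 * p t i (e s) + \sum_k (- (Z i i)^-1 * p t i k) * B t k s.
  move=> zi; have /matrixP/(_ i s) := PB t.
  rewrite -mulmxA mul_posmx zi mulmxDr [LHS]mxE mulmx_selr [RHS]mxE.
  have ies : i == e s = false.
    by apply/negbTE/eqP => ies; move: zi; rewrite ies Ze ltxx.
  rewrite Pi_plus_entry // ies mulr0n addr0 [X in _ + X]mxE.
  rewrite (eq_bigr (fun k => p t i k * B t k s + (if k == i then Z i i * B t i s else 0))).
    rewrite big_split /= -big_mkcond big_pred1_eq => h.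
    rewrite (eq_bigr (fun k => - (Z i i)^-1 * (p t i k * B t k s))).
      rewrite -mulr_sumr -mulrDr -invrN.
      apply: (canRL (mulKf _)); first by rewrite oppr_eq0 gt_eqF.
      by apply/eqP; rewrite mulNr eq_sym -addr_eq0 -addrA h.
    by move=> k _; rewrite mulrA.
  move=> k _; rewrite Pi_plus_entry // (eq_sym i k).
  case: eqVneq => [->|]; last by rewrite mulr0n !addr0.
  by rewrite mulr1n (zpos_gt0 zi); ring.
have pO i j : bigo 1 (fun t => p t i j) by exact: pdevO.
have B1 i : bigo 1 (fun t => B t i s).
  pose a i t := if 0 < Z i i then - (Z i i)^-1 * p t i (e s) else 0.
  pose c i k t := if 0 < Z i i then - (Z i i)^-1 * p t i k else 0.
  apply: (bigo_absorb (k := 1) (a := a) (b := fun i t => B t i s) (c := c)).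
  - by move=> j; rewrite /a; case: (0 < Z j j); [exact: bigoZ | exact: bigo0].
  - by move=> j k; rewrite /c; case: (0 < Z j j); [exact: bigoZ | exact: bigo0].
  - move=> j t; rewrite /a /c; case: ifP => zj; first exact: BE.
    by rewrite (B0 t j) ?zj // big1 ?addr0 // => k _; rewrite mul0r.
have B2 i : 0 < Z i i -> bigo 2 (fun t => B t i s + t * ((Z i i)^-1 * H i (e s))).
  move=> zi; apply: (@bigo_eq _ _ (fun t => - (Z i i)^-1 * (p t i (e s) - t * H i (e s))
     + \sum_k (- (Z i i)^-1 * p t i k) * B t k s)).
    by move=> t; rewrite [in RHS]BE //; ring.
  apply: bigoD; first by apply/bigoZ/pdev_pos; rewrite // Ze ltxx.
  by apply: bigo_sum => k _; apply: (@bigoM _ 1 1) => //; exact: bigoZ.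
apply: (@bigo_eq _ _ (fun t => \sum_i (p t (e r) i * B t i s
   + t ^+ 2 * (if 0 < Z i i then (Z i i)^-1 * H (e r) i * H i (e s) else 0)))).
  move=> t; rewrite big_split /= -mulr_sumr -big_mkcond -mulmxA mulmx_sell mxE.
  congr (_ + _); apply: eq_bigr => i _.
  by rewrite Pi_plus_entry // (zpos_eq0 (Ze r)) mul0rn addr0.
apply: bigo_sum => i _; case: (boolP (0 < Z i i)) => zi; last first.
  by apply: bigo_eq (bigo0 _) => t; rewrite B0 // !mulr0 addr0.
(* Each factor is replaced by its linear term in turn, leaving errors of orders 1 + 2 and 2 + 1. *)
apply: (@bigo_eq _ _ (fun t => p t (e r) i * (B t i s + t * ((Z i i)^-1 * H i (e s)))
   - (p t (e r) i - t * H (e r) i) * (t * ((Z i i)^-1 * H i (e s))))).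
  by move=> t; ring.
apply: bigoB; first by apply: (@bigoM _ 1 2); [exact: pO | exact: B2].
apply: (@bigoM _ 2 1); last exact: linO.
have := @pdev_pos _ _ Z H W dZ sH sW i (e r) zi; rewrite Ze ltxx => /(_ isT).
by apply: bigo_eq => t; rewrite pdev_sym // (symmxE _ _ sH).
Qed.

End ZeroBlock.

Section ZeroBlockExpansion.
Context {R : realType} {n : nat} (Z H W : 'M[R]_n).
Context (dZ : is_diag_mx Z) (sH : symmx H) (sW : symmx W).

Definition zev (s : 'I_#|zidx Z|) : 'I_n := enum_val s.

Lemma zevP s : Z (zev s) (zev s) = 0.
Proof. by have := enum_valP s; rewrite inE => /eqP. Qed.

Lemma zev_surj i : Z i i = 0 -> exists s, i = zev s.
Proof.
move=> zi; have iz : i \in zidx Z by rewrite inE zi.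
by exists (enum_rank_in iz i); rewrite /zev enum_rankK_in.
Qed.

(** V_0 collects the Schur corrections of both signs: t^2/2 V_0 is the quadratic term of the
    difference of the two Schur complements. *)
Definition V00 : 'M[R]_#|zidx Z| := \matrix_(r, s)
  (W (zev r) (zev s) - 2 * \sum_(l | Z l l != 0) (Z l l)^-1 * H (zev r) l * H l (zev s)).

Lemma sub00_sym (A : 'M[R]_n) : symmx A -> symmx (sub00 Z A).
Proof. by move=> sA; apply/matrixP => r s; rewrite !mxE (symmxE _ _ sA). Qed.

Lemma V00_sym : symmx V00.
Proof.
apply/matrixP => r s; rewrite !mxE (symmxE _ _ sW); congr (_ - 2 * _).
apply: eq_bigr => l _; rewrite (symmxE l _ sH) (symmxE _ l sH); ring.
Qed.

(** Both sides project onto the coordinates with Z_ii = 0; this is the gram hypothesis of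
    [Pi_plus_schur]. *)
Lemma selmx_gram : selmx zev *m (selmx zev)^T = 1%:M - posmx Z - posmx (- Z).
Proof.
apply/matrixP => i j; rewrite !mxE oppr_gt0.
have [zi|[s is_]] : Z i i != 0 \/ exists s, i = zev s.
  by have [/zev_surj|] := eqVneq (Z i i) 0; [right | left].
  rewrite big1 => [|s _].
    move: zi; have [_ _|_ _|_] := ltrgt0P (Z i i); rewrite ?eqxx // ?mul0rn ?subr0 ?subrr //.
  by rewrite !mxE (_ : (i == _) = false) ?mul0r //; apply: contra_neqF zi => /eqP ->; exact: zevP.
rewrite is_ zevP ltxx !mul0rn !subr0 (bigD1 s) //= big1 => [|r rs].
  by rewrite !mxE eqxx mul1r addr0 eq_sym.
by rewrite !mxE (inj_eq enum_val_inj) eq_sym (negPf rs) mul0r.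
Qed.

Lemma sum_sign (F : 'I_n -> R) :
  \sum_i F i = \sum_(i | 0 < Z i i) F i + \sum_(i | Z i i == 0) F i
    + \sum_(i | Z i i < 0) F i.
Proof.
rewrite (bigID (fun i => 0 < Z i i)) /= -addrA; congr (_ + _).
rewrite (bigID (fun i => Z i i == 0)) /=; congr (_ + _); apply: eq_bigl => i.
  by have [] := ltrgt0P (Z i i).
by have [] := ltrgt0P (Z i i).
Qed.

Lemma sum_neq0 (F : 'I_n -> R) :
  \sum_(i | Z i i != 0) F i = \sum_(i | 0 < Z i i) F i + \sum_(i | Z i i < 0) F i.
Proof.
rewrite (bigID (fun i => 0 < Z i i)) /=; congr (_ + _); apply: eq_bigl => i.
  by have [] := ltrgt0P (Z i i).
by have [] := ltrgt0P (Z i i).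
Qed.

(* The (0,0) block of P is its Schur complement plus the t^2 sum, the former
   being Pi_plus (t H_00 + t^2/2 V_0) up to O(t^3). *)
Lemma zero_block_expand r s : bigo 3 (fun t =>
   Pi_plus (curve Z H W t) (zev r) (zev s)
   - t ^+ 2 * \sum_(i | 0 < Z i i) (Z i i)^-1 * H (zev r) i * H i (zev s)
   - t * Pi_plus (sub00 Z H + (t / 2) *: V00) r s).
Proof.
set E : 'M[R]_(n, #|zidx Z|) := selmx zev.
pose A := curve Z H W; pose P t := Pi_plus (A t); pose N t := P t - A t.
have sA t : symmx (A t) by exact: curve_sym.
have NE t : Pi_plus (curve (- Z) (- H) (- W) t) = N t by rewrite curveN Pi_plusN.
(* The corrections are chosen for each t separately; no regularity in t is asked of them, as their
   size follows from their equations. *)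
have [B HB] := choice (fun t => let: And4 pP _ _ _ := Pi_plusP (sA t) in
  psdmx_schur_solvable E pP (posmx_sym Z) (posmx_idem Z)).
have [C HC] := choice (fun t => let: And4 _ pN _ _ := Pi_plusP (sA t) in
  psdmx_schur_solvable E pN (posmx_sym (- Z)) (posmx_idem (- Z))).
have dZN : is_diag_mx (- Z).
  by apply/is_diag_mxP => i j ij; rewrite mxE; move/is_diag_mxP: dZ => /(_ _ _ ij) ->; rewrite oppr0.
have sN (X : 'M[R]_n) : symmx X -> symmx (- X) by rewrite /symmx linearN /= => ->.
have BO := schur_corr_expand dZ sH sW zevP (fun t => proj1 (HB t)) (fun t => proj2 (HB t)).
have zevPN u : (- Z) (zev u) (zev u) = 0 by rewrite mxE zevP oppr0.
(* N is the projection of the negated curve, so the negative block is the positive one for -Z, -H,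
   -W. *)
have CO := @schur_corr_expand _ _ _ zev (- Z) (- H) (- W) C dZN (sN _ sH) (sN _ sW) zevPN
  (fun t => proj1 (HC t)).
have {}CO u v : bigo 3 (fun t => (E^T *m N t *m C t) u v
    - t ^+ 2 * \sum_(i | Z i i < 0) (Z i i)^-1 * H (zev u) i * H i (zev v)).
  have := CO _ u v; move=> h; apply: bigo_eq (h _) => t; last by rewrite NE; exact: proj2 (HC t).
  rewrite NE; congr (_ + _); rewrite -mulrN -sumrN; congr (_ * _).
  apply: eq_big => [i|i _]; first by rewrite mxE oppr_gt0.
  by rewrite !mxE invrN; ring.
pose X t := E^T *m (P t - N t) *m E + E^T *m P t *m B t - E^T *m N t *m C t.
have XE t : Pi_plus (X t) = E^T *m P t *m E + E^T *m P t *m B t.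
  have [pP pN PN _] := Pi_plusP (sA t); have [B1 B2] := HB t; have [C1 C2] := HC t.
  apply: (@Pi_plus_schur _ _ _ _ _ (posmx Z) (posmx (- Z))) => //; try exact: posmx_sym.
  exact: selmx_gram.
(* The factor t is taken out so that positive homogeneity reduces to [Pi_plus] near H_00. *)
pose Y t := t *: (sub00 Z H + (t / 2) *: V00).
have XY u v : bigo 3 (fun t => X t u v - Y t u v).
  apply: bigo_eq (bigoB (BO u v) (CO u v)) => t.
  rewrite /X /Y (_ : P t - N t = A t); last by rewrite /N opprB addrC subrK.
  have -> (U V T : 'M[R]_#|zidx Z|) : (U + V - T) u v = U u v + V u v - T u v.
    by rewrite !mxE.
  rewrite mulmx_selr mulmx_sell /A /curve !mxE sum_neq0.
  have -> : Z (zev u) (zev v) = 0.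
    have [->|uv] := eqVneq u v; first exact: zevP.
    move/is_diag_mxP: dZ => -> //.
    by apply: contra_neq uv => /val_inj/enum_val_inj.
  by field.
have sY t : symmx (Y t).
  by apply/symmxZ/symmxD; [exact: sub00_sym | exact/symmxZ/V00_sym].
(* The equation for D gives E^T M D = - D^T M D, which is visibly symmetric. *)
have corr_sym (M J : 'M[R]_n) (D : 'M[R]_(n, #|zidx Z|)) : symmx M -> symmx J ->
    J *m D = D -> J *m M *m (E + D) = 0 -> symmx (E^T *m M *m D).
  move=> sM sJ JD h.
  have -> : E^T *m M *m D = - (D^T *m M *m D).
    have h' := congr1 trmx h; rewrite trmx0 !trmx_mul sM sJ linearD /= in h'.
    have : (E^T + D^T) *m (M *m J) *m D = 0 by rewrite h' mul0mx.
    rewrite -mulmxA -(mulmxA M) JD mulmxDl mulmxA mulmxA => /eqP.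
    by rewrite addr_eq0 => /eqP.
  by rewrite /symmx linearN /= !trmx_mul trmxK sM mulmxA.
have sX t : symmx (X t).
  have [B1 B2] := HB t; have [C1 C2] := HC t.
  have sP := Pi_plus_sym (sA t); have sNt : symmx (N t) by exact: symmxB.
  apply: symmxB; last exact: (corr_sym _ (posmx (- Z)) _ _ (posmx_sym _)).
  apply: symmxD; last exact: (corr_sym _ (posmx Z) _ _ (posmx_sym _)).
  exact/symmx_conj/symmxB.
apply: bigo_near (bigoB (Pi_plus_bigo sX sY XY r s) (BO r s)).
near=> t; rewrite XE /Y Pi_plusZ.
- rewrite [X in X - _ - _]mxE mulmx_selr mulmx_sell [X in _ - X - _]mxE /P.
  rewrite /E /A; ring.
- by apply/ltW; near: t; exact: near_pos.
- by apply/symmxD; [exact: sub00_sym | exact/symmxZ/V00_sym].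
Unshelve. all: by end_near.
Qed.

End ZeroBlockExpansion.

(** * First and second order expansions *)

Section Limits.
Context {R : realType} {n : nat}.
Implicit Types Z H W D : 'M[R]_n.

(** The remainder is O(t^2) rather than o(t): on the zero block this expansion, taken at H_00, is
    multiplied by t and has to give O(t^3). *)
Definition expands1 Z H D := forall i j,
  bigo 2 (fun t => (Pi_plus (Z + t *: H) - Pi_plus Z - t *: D) i j).

Definition expands2 Z H W D D' := forall i j,
  bigo 3 (fun t => (Pi_plus (curve Z H W t) - Pi_plus Z - t *: D
                    - ((t ^+ 2) / 2) *: D') i j).

Lemma near_neq0 : \forall t \near (0 : R)^'+, t != 0.
Proof. by apply: filterS near_pos => t t0; rewrite gt_eqF. Qed.

Lemma expands1_cvg Z H D : expands1 Z H D -> dd1_quot Z H @ 0^'+ --> D.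
Proof.
move=> ZD; apply: bigo_mx_cvg => i j; apply: (@bigo_powM _ 1).
apply: bigo_near (ZD i j); apply: filterS near_neq0 => t t0.
by rewrite /dd1_quot !mxE; field.
Qed.

Lemma expands1_lim Z H D : expands1 Z H D ->
  cvg (dd1_quot Z H @ 0^'+) /\ Pi_plus' Z H = D.
Proof.
move=> /expands1_cvg h; split; first by apply/cvg_ex; exists D.
exact: (cvg_lim (@norm_hausdorff _ _) h).
Qed.

Lemma expands2_lim Z H W D D' : expands1 Z H D -> expands2 Z H W D D' ->
  cvg (dd2_quot Z H W @ 0^'+) /\ Pi_plus'' Z H W = D'.
Proof.
move=> /expands1_lim[_ dE] ZD; have h : dd2_quot Z H W @ 0^'+ --> D'.
  apply: bigo_mx_cvg => i j; apply: (@bigo_powM _ 2).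
  apply: bigo_near (bigoZ 2 (ZD i j)); apply: filterS near_neq0 => t t0.
  by rewrite /dd2_quot dE /curve !mxE; field.
split; first by apply/cvg_ex; exists D'.
exact: (cvg_lim (@norm_hausdorff _ _) h).
Qed.

Lemma bigo_conj k (Q : 'M[R]_n) (F : R -> 'M[R]_n) :
  (forall i j, bigo k (fun t => F t i j)) ->
  forall i j, bigo k (fun t => (Q *m F t *m Q^T) i j).
Proof.
move=> FO i j.
apply: (@bigo_eq _ _ (fun t => \sum_l (\sum_h Q i h * F t h l) * Q j l)).
  move=> t; rewrite [RHS]mxE; apply: eq_bigr => l _.
  by rewrite [in RHS]mxE [Q^T _ _]mxE.
apply: bigo_sum => l _; rewrite -[k]addn0; apply: bigoM; last exact: bigo_cst.
by apply: bigo_sum => h _; exact: bigoZ.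
Qed.

Lemma conj_cancel (Q A : 'M[R]_n) : Q^T *m Q = 1%:M ->
  Q *m (Q^T *m A *m Q) *m Q^T = A.
Proof.
move=> /mulmx1C QQ'; by rewrite !mulmxA QQ' mul1mx -mulmxA QQ' mulmx1.
Qed.

Lemma expands1_conj Q Z H D : Q^T *m Q = 1%:M -> symmx Z -> symmx H ->
  expands1 (Q^T *m Z *m Q) (Q^T *m H *m Q) D -> expands1 Z H (Q *m D *m Q^T).
Proof.
move=> QQ sZ sH h i j; apply: bigo_eq (bigo_conj Q h i j) => t.
rewrite (_ : Q^T *m Z *m Q + t *: _ = Q^T *m (Z + t *: H) *m Q); last first.
  by rewrite mulmxDr mulmxDl -scalemxAr -scalemxAl.
rewrite !Pi_plus_conj //; last by apply: symmxD => //; exact: symmxZ.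
by rewrite 2!mulmxBr 2!mulmxBl !conj_cancel // -scalemxAr -scalemxAl.
Qed.

Lemma expands2_conj Q Z H W D D' : Q^T *m Q = 1%:M -> symmx Z -> symmx H -> symmx W ->
  expands2 (Q^T *m Z *m Q) (Q^T *m H *m Q) (Q^T *m W *m Q) D D' ->
  expands2 Z H W (Q *m D *m Q^T) (Q *m D' *m Q^T).
Proof.
move=> QQ sZ sH sW h i j; apply: bigo_eq (bigo_conj Q h i j) => t.
rewrite (_ : curve _ _ _ _ = Q^T *m curve Z H W t *m Q); last first.
  by rewrite /curve 2!mulmxDr 2!mulmxDl -!scalemxAr -!scalemxAl.
rewrite !Pi_plus_conj //; last first.
  by apply: symmxD; [apply: symmxD => //|]; exact: symmxZ.
by rewrite 3!mulmxBr 3!mulmxBl !conj_cancel // -!scalemxAr -!scalemxAl.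
Qed.

End Limits.

(** * First-order expansion and directional derivative *)

Section FirstOrder.
Context {R : realType} {n : nat}.
Implicit Types Z H W : 'M[R]_n.

(** For a pivot pair the fraction is the divided difference of x |-> max(x, 0) at Z_ii and Z_jj, as
    in Loewner's formula. *)
Definition slope Z H i j : R := zpos Z i / (zpos Z i + zneg Z j) * H i j.

Definition dPi_plus Z H : 'M[R]_n := \matrix_(i, j)
  if pivot Z i j then slope Z H i j else
  if pivot Z j i then slope Z H j i else
  (selmx (@zev _ _ Z) *m Pi_plus (sub00 Z H) *m (selmx (@zev _ _ Z))^T) i j.

Lemma selmx_conjE Z (X : 'M[R]_#|zidx Z|) r s :
  (selmx (@zev _ _ Z) *m X *m (selmx (@zev _ _ Z))^T) (zev r) (zev s) = X r s.
Proof.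
rewrite mxE (bigD1 s) //= big1 => [|l ls]; last first.
  by rewrite !mxE (inj_eq enum_val_inj) eq_sym (negPf ls) mulr0.
rewrite mxE (bigD1 r) //= big1 => [|l lr]; last first.
  by rewrite !mxE (inj_eq enum_val_inj) eq_sym (negPf lr) mul0r.
by rewrite !mxE !eqxx mul1r mulr1 !addr0.
Qed.

Lemma pivotN Z i j : ~~ pivot Z i j -> ~~ pivot Z j i -> Z i i = 0 /\ Z j j = 0.
Proof.
rewrite /pivot !negbK => /eqP + /eqP.
have [zi|zi|zi] := ltrgt0P (Z i i); have [zj|zj|zj] := ltrgt0P (Z j j);
  rewrite ?(zpos_gt0 zi) ?(zpos_gt0 zj) ?(zpos_lt0 zi) ?(zpos_lt0 zj)
    ?(zpos_eq0 zi) ?(zpos_eq0 zj) => h1 h2; split => //; lra.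
Qed.

Lemma dPi_plus_zero Z H r s : dPi_plus Z H (zev r) (zev s) = Pi_plus (sub00 Z H) r s.
Proof.
rewrite mxE selmx_conjE /pivot !(zpos_eq0 (zevP _)) addr0 eqxx //.
Qed.

(** The coefficient does not involve W, so the result serves both the line (W = 0) and the curve. On
    the zero block, the quadratic sum of [zero_block_expand] goes into the remainder. *)
Lemma pdev_expand Z H W i j : is_diag_mx Z -> symmx H -> symmx W ->
  bigo 2 (fun t => pdev Z H W t i j - t * dPi_plus Z H i j).
Proof.
move=> dZ sH sW; have [g|g] := boolP (pivot Z i j).
  by apply: bigo_eq (pdev_pivot1 dZ sH sW g) => t; rewrite [dPi_plus Z H i j]mxE g.
have [g'|g'] := boolP (pivot Z j i).
  apply: bigo_eq (pdev_pivot1 dZ sH sW g') => t.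
  by rewrite [dPi_plus Z H i j]mxE (negPf g) g' pdev_sym.
have [/zev_surj[r ->] /zev_surj[s ->]] := pivotN g g'.
have h := zero_block_expand dZ sH sW r s.
have sX t : symmx (sub00 Z H + (t / 2) *: V00 Z H W).
  by apply: symmxD; [exact: sub00_sym | exact/symmxZ/V00_sym].
have h1 := @Pi_plus_bigo _ 1 _ (fun t => sub00 Z H + (t / 2) *: V00 Z H W)
  (fun=> sub00 Z H) sX (fun=> sub00_sym Z sH) _ r s.
have {}h1 : bigo 1 (fun t => Pi_plus (sub00 Z H + (t / 2) *: V00 Z H W) r s
    - Pi_plus (sub00 Z H) r s).
  apply: h1 => u v; apply: bigo_eq (linO (V00 Z H W u v / 2)) => t.
  by rewrite [in RHS]mxE [X in _ = _ + X - _]mxE; ring.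
pose c := \sum_(i | 0 < Z i i) (Z i i)^-1 * H (zev r) i * H i (zev s).
have h2 : bigo 2 (fun t => t ^+ 2 / 2 * (2 * c)) by exact: quadO.
have h3 := bigoM (bigo_pow 1) h1.
apply: bigo_eq (bigoD (bigoD (bigo_le (isT : (2 <= 3)%N) h) h2) h3) => t.
rewrite Pi_plus_entry // (zpos_eq0 (zevP _)) mul0rn addr0 dPi_plus_zero -/c.
by field.
Qed.

Lemma symmx0 : symmx (0 : 'M[R]_n).
Proof. exact: trmx0. Qed.

(** Inherited from the symmetry of [pdev] by uniqueness of the linear coefficient, which avoids a
    case analysis on pivots. *)
Lemma dPi_plus_sym Z H : is_diag_mx Z -> symmx H -> symmx (dPi_plus Z H).
Proof.
move=> dZ sH; apply/matrixP => i j; rewrite mxE; apply/eqP; rewrite -subr_eq0.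
apply/eqP/bigo_cst_eq0; apply: (@bigo_powM _ 1).
apply: bigo_eq (bigoB (pdev_expand i j dZ sH symmx0) (pdev_expand j i dZ sH symmx0)) => t.
by rewrite (pdev_sym dZ sH symmx0 t j i); ring.
Qed.

Lemma expands1_diag Z H : is_diag_mx Z -> symmx H -> expands1 Z H (dPi_plus Z H).
Proof.
move=> dZ sH i j; apply: bigo_eq (pdev_expand i j dZ sH symmx0) => t.
by rewrite /pdev /curve scaler0 addr0 !mxE.
Qed.

(** The non-diagonal case is what the zero block requires, at H_00 in direction V_0. *)
Lemma expands1_exists Z H : symmx Z -> symmx H -> exists D, expands1 Z H D.
Proof.
move=> sZ sH; have [Q QQ dQ] := symmetric_spectral sZ.
by eexists; apply: (expands1_conj QQ sZ sH); apply: expands1_diag; last exact: symmx_conj.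
Qed.

Lemma Pi_plus'_expand Z H : symmx Z -> symmx H -> expands1 Z H (Pi_plus' Z H).
Proof. by move=> sZ sH; have [D hD] := expands1_exists sZ sH; have [_ ->] := expands1_lim hD. Qed.

End FirstOrder.

(** * Second-order expansion at a diagonal matrix *)

Section SecondOrder.
Context {R : realType} {n : nat} (Z H W : 'M[R]_n).
Context (dZ : is_diag_mx Z) (sH : symmx H) (sW : symmx W).

(** The coefficient of t^2/2 in [pdev_pivot] after putting p = t D and q = t (D - H) in the
    products. *)
Definition curvature i j : R :=
  (zpos Z i * W i j - 2 * \sum_k dPi_plus Z H i k * (dPi_plus Z H k j - H k j))
  / (zpos Z i + zneg Z j).

Definition zero_curvature : 'M[R]_#|zidx Z| := \matrix_(r, s)
  (2 * (\sum_(c | 0 < Z c c) (Z c c)^-1 * H (zev r) c * H c (zev s))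
   + Pi_plus' (sub00 Z H) (V00 Z H W) r s).

Definition d2Pi_plus : 'M[R]_n := \matrix_(i, j)
  if pivot Z i j then curvature i j else
  if pivot Z j i then curvature j i else
  (selmx (@zev _ _ Z) *m zero_curvature *m (selmx (@zev _ _ Z))^T) i j.

(** First-order knowledge suffices: p and q are O(t) and known up to O(t^2), hence their products up
    to O(t^3). The zero block uses the first-order expansion of [Pi_plus] at H_00. *)
Lemma pdev_expand2 i j :
  bigo 3 (fun t => pdev Z H W t i j - t * dPi_plus Z H i j - t ^+ 2 / 2 * d2Pi_plus i j).
Proof.
have pivotO k l : pivot Z k l ->
    bigo 3 (fun t => pdev Z H W t k l - t * dPi_plus Z H k l - t ^+ 2 / 2 * curvature k l).
  move=> g.
  have h : bigo 3 (fun t => \sum_c (pdev Z H W t k c * ndev Z H W t c l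
      - t ^+ 2 * (dPi_plus Z H k c * (dPi_plus Z H c l - H c l)))).
    apply: bigo_sum => c _.
    have n2 : bigo 2 (fun t => ndev Z H W t c l - t * (dPi_plus Z H c l - H c l)).
      apply: bigo_eq (bigoB (pdev_expand c l dZ sH sW) (quadO (W c l))) => t.
      by rewrite ndevE; ring.
    apply: bigo_eq (bigoD (@bigoM _ 1 2 _ _ (pdevO dZ sH sW k c) n2)
      (@bigoM _ 2 1 _ _ (pdev_expand k c dZ sH sW) (linO (dPi_plus Z H c l - H c l)))) => t.
    by ring.
  apply: bigo_eq (bigoZ (- (zpos Z k + zneg Z l)^-1) h) => t.
  rewrite pdev_pivot // /curvature [dPi_plus Z H k l]mxE g /slope sumrB -mulr_sumr.
  by move: g; rewrite /pivot => g; field.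
have [g|g] := boolP (pivot Z i j).
  by apply: bigo_eq (pivotO _ _ g) => t; rewrite [d2Pi_plus i j]mxE g.
have [g'|g'] := boolP (pivot Z j i).
  apply: bigo_eq (pivotO _ _ g') => t.
  by rewrite [d2Pi_plus i j]mxE (negPf g) g' pdev_sym // (symmxE _ _ (dPi_plus_sym dZ sH)).
have [/zev_surj[r ir] /zev_surj[s js]] := pivotN g g'.
have -> : d2Pi_plus i j = zero_curvature r s.
  by rewrite [d2Pi_plus i j]mxE (negPf g) (negPf g') ir js selmx_conjE.
rewrite ir js dPi_plus_zero.
have h := zero_block_expand dZ sH sW r s.
have h1 := Pi_plus'_expand (sub00_sym Z sH) (V00_sym Z sH sW) r s.
have {}h1 : bigo 2 (fun t => Pi_plus (sub00 Z H + (t / 2) *: V00 Z H W) r s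
   - Pi_plus (sub00 Z H) r s - t / 2 * Pi_plus' (sub00 Z H) (V00 Z H W) r s).
  by apply: bigo_eq (bigo_half h1) => t; rewrite !mxE.
have h3 := bigoM (bigo_pow 1) h1.
apply: bigo_eq (bigoD h h3) => t.
rewrite Pi_plus_entry // (zpos_eq0 (zevP _)) mul0rn addr0 [zero_curvature r s]mxE.
by field.
Qed.

Lemma expands2_diag : expands2 Z H W (dPi_plus Z H) d2Pi_plus.
Proof.
by move=> i j; apply: bigo_eq (pdev_expand2 i j) => t; rewrite /pdev !mxE.
Qed.

End SecondOrder.

(** * Explicit formulas for the blocks *)

Section Blocks.
Context {R : realType} {n : nat} (Z H W : 'M[R]_n).
Context (dZ : is_diag_mx Z) (sH : symmx H) (sW : symmx W).
Notation D := (dPi_plus Z H).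
Notation M := (d2Pi_plus Z H W).

Lemma dPi_plus_pos i k : 0 < Z i i -> D i k = Z i i / (Z i i + zneg Z k) * H i k.
Proof.
move=> zi; have g : pivot Z i k.
  rewrite /pivot (zpos_gt0 zi) gt_eqF // ltr_pwDl //.
  by rewrite /zneg le_max lexx orbT.
by rewrite mxE g /slope (zpos_gt0 zi).
Qed.

Lemma dPi_plus_neg i k : Z k k < 0 -> D i k = zpos Z i / (zpos Z i - Z k k) * H i k.
Proof.
move=> zk; have g : pivot Z i k.
  rewrite /pivot (zpos_lt0 zk) gt_eqF // ltr_wpDl ?oppr_gt0 //.
  by rewrite /zpos le_max lexx orbT.
by rewrite mxE g /slope (zpos_lt0 zk).
Qed.

(** Goes through the symmetry of D because (k, j) is not a pivot pair when Z_kk < 0. *)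
Lemma dPi_plus_posr k j : 0 < Z j j -> D k j = Z j j / (Z j j + zneg Z k) * H k j.
Proof. by move=> zj; rewrite (symmxE _ _ (dPi_plus_sym dZ sH)) dPi_plus_pos // (symmxE j k sH). Qed.

Lemma dPi_plus_negl i k : Z i i < 0 -> D i k = zpos Z k / (zpos Z k - Z i i) * H i k.
Proof. by move=> zi; rewrite (symmxE _ _ (dPi_plus_sym dZ sH)) dPi_plus_neg // (symmxE i k sH). Qed.

Lemma dPi_plus_pos_eq i k : 0 < Z i i -> zneg Z k = 0 -> D i k = H i k.
Proof. by move=> zi zk; rewrite dPi_plus_pos // zk addr0 divff ?mul1r // gt_eqF. Qed.

Lemma dPi_plus_posr_eq k j : 0 < Z j j -> zneg Z k = 0 -> D k j = H k j.
Proof. by move=> zi zk; rewrite dPi_plus_posr // zk addr0 divff ?mul1r // gt_eqF. Qed.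

Lemma dPi_plus_neg_eq0 i k : Z k k < 0 -> zpos Z i = 0 -> D i k = 0.
Proof. by move=> zk zi; rewrite dPi_plus_neg // zi !mul0r. Qed.

Lemma dPi_plus_negl_eq0 i k : Z i i < 0 -> zpos Z k = 0 -> D i k = 0.
Proof. by move=> zi zk; rewrite dPi_plus_negl // zk !mul0r. Qed.

Lemma sum_zev (F : 'I_n -> R) : \sum_(i | Z i i == 0) F i = \sum_s F (@zev _ _ Z s).
Proof. by rewrite -big_enum_val; apply: eq_bigl => i; rewrite inE. Qed.

Lemma d2Pi_plus_pivot i j : pivot Z i j -> M i j =
  (zpos Z i * W i j - 2 * (\sum_(k | 0 < Z k k) D i k * (D k j - H k j)
      + \sum_(k | Z k k == 0) D i k * (D k j - H k j)
      + \sum_(k | Z k k < 0) D i k * (D k j - H k j))) / (zpos Z i + zneg Z j).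
Proof. by move=> g; rewrite mxE g /curvature (sum_sign Z). Qed.

(** For k in the positive or zero block D_kj = H_kj, so only negative k contribute. *)
Lemma d2Pi_plus_pos_pos i j : 0 < Z i i -> 0 < Z j j ->
  M i j = W i j + 2 * \sum_(c | Z c c < 0)
    (- Z c c) / ((Z c c - Z i i) * (Z c c - Z j j)) * H i c * H c j.
Proof.
move=> zi zj; have zi0 : Z i i != 0 by rewrite gt_eqF.
rewrite d2Pi_plus_pivot /pivot ?(zpos_gt0 zi) ?(zpos_gt0 zj) ?addr0 //.
rewrite big1 => [|k zk]; last by rewrite [D k j]dPi_plus_posr_eq ?(zpos_gt0 zk) // subrr mulr0.
rewrite big1 => [|k /eqP zk]; last by rewrite [D k j]dPi_plus_posr_eq ?(zpos_eq0 zk) // subrr mulr0.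
(* The factor [- Z i i] is pulled out to cancel the pivot; the other blocks proceed alike. *)
rewrite (eq_bigr (fun c => - Z i i *
    ((- Z c c) / ((Z c c - Z i i) * (Z c c - Z j j)) * H i c * H c j))).
  by rewrite -mulr_sumr; field.
move=> k zk; rewrite dPi_plus_pos // dPi_plus_posr // (zpos_lt0 zk).
by field; rewrite !subr_eq0 ?addr_eq0; repeat (apply/andP; split); apply/eqP => h; lra.
Qed.

(** On the zero block D - H is Pi_+(H_00) - H_00 = Pi_+(-H_00), the source of the last term;
    positive k drop out. *)
Lemma d2Pi_plus_pos_zero i s : 0 < Z i i ->
  M i (zev s) = W i (zev s)
    + 2 * \sum_(c | Z c c < 0) (Z i i - Z c c)^-1 * H i c * H c (zev s)
    - 2 / Z i i * \sum_r H i (zev r) * Pi_plus (- sub00 Z H) r s.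
Proof.
move=> zi; have zi0 : Z i i != 0 by rewrite gt_eqF.
rewrite d2Pi_plus_pivot /pivot ?(zpos_gt0 zi) ?(zpos_eq0 (zevP s)) ?addr0 //.
rewrite big1 => [|k zk]; last first.
  by rewrite [D k _]dPi_plus_pos_eq ?(zpos_eq0 (zevP s)) // subrr mulr0.
rewrite sum_zev (eq_bigr (fun r => H i (zev r) * Pi_plus (- sub00 Z H) r s)); last first.
  move=> r _; rewrite dPi_plus_pos_eq ?(zpos_eq0 (zevP r)) // dPi_plus_zero.
  by rewrite (Pi_plusN (sub00_sym Z sH)) !mxE.
rewrite (eq_bigr (fun c => - Z i i * ((Z i i - Z c c)^-1 * H i c * H c (zev s)))).
  by rewrite -mulr_sumr; field.
move=> k zk; rewrite [D k _]dPi_plus_negl_eq0 ?(zpos_eq0 (zevP s)) // dPi_plus_pos // (zpos_lt0 zk).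
by field; apply/eqP => h; lra.
Qed.

Lemma d2Pi_plus_pos_neg i j : 0 < Z i i -> Z j j < 0 ->
  M i j = Z i i / (Z i i - Z j j) * W i j
    + 2 * \sum_(c | 0 < Z c c)
        (- Z j j) / ((Z j j - Z i i) * (Z j j - Z c c)) * H i c * H c j
    + 2 / (Z i i - Z j j) * \sum_(c | Z c c == 0) H i c * H c j
    + 2 * \sum_(c | Z c c < 0)
        Z i i / ((Z i i - Z j j) * (Z i i - Z c c)) * H i c * H c j.
Proof.
move=> zi zj; have zij : Z i i - Z j j != 0 by apply/eqP => h; lra.
rewrite d2Pi_plus_pivot /pivot ?(zpos_gt0 zi) ?(zpos_lt0 zj) //.
rewrite (eq_bigr (fun c => - (Z i i - Z j j) *
    ((- Z j j) / ((Z j j - Z i i) * (Z j j - Z c c)) * H i c * H c j))); last first.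
  move=> k zk; rewrite dPi_plus_pos_eq ?(zpos_gt0 zk) // dPi_plus_pos // (zpos_lt0 zj).
  by field; repeat (apply/andP; split); apply/eqP => h; lra.
rewrite [X in _ + X + _](eq_bigr (fun c => - 1 * (H i c * H c j))); last first.
  move=> k /eqP zk; rewrite dPi_plus_pos_eq ?(zpos_eq0 zk) // dPi_plus_neg_eq0 ?(zpos_eq0 zk) //; ring.
rewrite [X in _ + _ + X](eq_bigr (fun c => - (Z i i - Z j j) *
    (Z i i / ((Z i i - Z j j) * (Z i i - Z c c)) * H i c * H c j))); last first.
  move=> k zk; rewrite dPi_plus_pos // [D k j]dPi_plus_neg_eq0 ?(zpos_lt0 zk) //.
  by field; repeat (apply/andP; split); apply/eqP => h; lra.
by rewrite -!mulr_sumr; field.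
Qed.

Lemma d2Pi_plus_zero_zero r s : M (zev r) (zev s) =
  2 * (\sum_(c | 0 < Z c c) (Z c c)^-1 * H (zev r) c * H c (zev s))
  + Pi_plus' (sub00 Z H) (V00 Z H W) r s.
Proof.
by rewrite [LHS]mxE /pivot !(zpos_eq0 (zevP _)) addr0 eqxx /= selmx_conjE mxE.
Qed.

(** Here D vanishes between the zero and negative blocks: negative k drop out and zero k contribute
    - Pi_+(H_00) H. *)
Lemma d2Pi_plus_zero_neg r j : Z j j < 0 ->
  M (zev r) j =
    2 * \sum_(c | 0 < Z c c) (Z c c - Z j j)^-1 * H (zev r) c * H c j
    + 2 / (- Z j j) * \sum_s Pi_plus (sub00 Z H) r s * H (zev s) j.
Proof.
move=> zj; have zj0 : Z j j != 0 by rewrite lt_eqF.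
rewrite d2Pi_plus_pivot /pivot ?(zpos_eq0 (zevP r)) ?(zpos_lt0 zj) ?add0r ?oppr_eq0 //.
rewrite (eq_bigr (fun c => Z j j *
    ((Z c c - Z j j)^-1 * H (zev r) c * H c j))); last first.
  move=> k zk; rewrite dPi_plus_posr_eq ?(zpos_eq0 (zevP r)) // dPi_plus_pos // (zpos_lt0 zj).
  by field; apply/eqP => h; lra.
rewrite sum_zev.
rewrite [X in _ + X + _](eq_bigr (fun s =>
    - 1 * (Pi_plus (sub00 Z H) r s * H (zev s) j))); last first.
  move=> s _; rewrite dPi_plus_zero dPi_plus_neg_eq0 ?(zpos_eq0 (zevP s)) //; ring.
rewrite [X in _ + _ + X]big1 => [|k zk]; last by rewrite dPi_plus_neg_eq0 ?mul0r ?(zpos_eq0 (zevP r)).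
by rewrite -!mulr_sumr; field.
Qed.

Lemma d2Pi_plus_neg_neg i j : Z i i < 0 -> Z j j < 0 ->
  M i j = 2 * \sum_(c | 0 < Z c c)
    Z c c / ((Z c c - Z i i) * (Z c c - Z j j)) * H i c * H c j.
Proof.
move=> zi zj; have zj0 : Z j j != 0 by rewrite lt_eqF.
rewrite d2Pi_plus_pivot /pivot ?(zpos_lt0 zi) ?(zpos_lt0 zj) ?add0r ?oppr_eq0 //.
rewrite [X in _ + X + _]big1 => [|k /eqP zk]; last first.
  by rewrite dPi_plus_negl_eq0 ?mul0r ?(zpos_eq0 zk).
rewrite [X in _ + _ + X]big1 => [|k zk]; last by rewrite dPi_plus_negl_eq0 ?mul0r ?(zpos_lt0 zk).
rewrite (eq_bigr (fun c => Z j j *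
    (Z c c / ((Z c c - Z i i) * (Z c c - Z j j)) * H i c * H c j))).
  by rewrite -mulr_sumr; field.
move=> k zk; rewrite dPi_plus_posr // dPi_plus_pos // (zpos_lt0 zi) (zpos_lt0 zj).
by field; repeat (apply/andP; split); apply/eqP => h; lra.
Qed.

Lemma d2Pi_plus_sym : symmx M.
Proof.
apply/matrixP => i j; rewrite mxE; apply/eqP; rewrite -subr_eq0; apply/eqP.
apply: bigo_cst_eq0; apply: (@bigo_powM _ 2).
apply: bigo_eq (bigoZ 2 (bigoB (pdev_expand2 dZ sH sW i j) (pdev_expand2 dZ sH sW j i))) => t.
by rewrite (pdev_sym dZ sH sW t j i) (symmxE j i (dPi_plus_sym dZ sH)); field.
Qed.

End Blocks.

(** Blocks are stated entrywise: a sum over eigenvalues of block products becomes one sum over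
    indices c of the given sign. Convergence is asserted too, because [lim] is total and its value
    alone would not give it. *)
Theorem theorem3p2 (R : realType) (n : nat) :
  (forall Z H W : 'M[R]_n,
     is_diag_mx Z -> symmx H -> symmx W ->
     let M := Pi_plus'' Z H W in
     let ev := fun p : 'I_#|zidx Z| => (enum_val p : 'I_n) in
     let H00 := sub00 Z H in
     let V0 := \matrix_(p, q)
         (W (ev p) (ev q)
          - 2 * \sum_(l | Z l l != 0) (Z l l)^-1 * H (ev p) l * H l (ev q))
       : 'M[R]_#|zidx Z| in
     [/\ cvg (dd1_quot Z H @ 0^'+), cvg (dd2_quot Z H W @ 0^'+),
         cvg (dd1_quot H00 V0 @ 0^'+) & M^T = M] /\
     (* a, b in Omega_+ *)
     (forall i j, 0 < Z i i -> 0 < Z j j ->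
        M i j = W i j + 2 * \sum_(c | Z c c < 0)
          (- Z c c) / ((Z c c - Z i i) * (Z c c - Z j j)) * H i c * H c j) /\
     (* a in Omega_+, block 0 *)
     (forall i q, 0 < Z i i ->
        M i (ev q) = W i (ev q)
          + 2 * \sum_(c | Z c c < 0) (Z i i - Z c c)^-1 * H i c * H c (ev q)
          - 2 / Z i i * \sum_p H i (ev p) * Pi_plus (- H00) p q) /\
     (* a in Omega_+, b in Omega_- *)
     (forall i j, 0 < Z i i -> Z j j < 0 ->
        M i j = Z i i / (Z i i - Z j j) * W i j
          + 2 * \sum_(c | 0 < Z c c)
              (- Z j j) / ((Z j j - Z i i) * (Z j j - Z c c)) * H i c * H c j
          + 2 / (Z i i - Z j j) * \sum_(c | Z c c == 0) H i c * H c j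
          + 2 * \sum_(c | Z c c < 0)
              Z i i / ((Z i i - Z j j) * (Z i i - Z c c)) * H i c * H c j) /\
     (* the zero block *)
     (forall p q,
        M (ev p) (ev q) =
          2 * \sum_(c | 0 < Z c c) (Z c c)^-1 * H (ev p) c * H c (ev q)
          + Pi_plus' H00 V0 p q) /\
     (* block 0, b in Omega_- *)
     (forall p j, Z j j < 0 ->
        M (ev p) j =
          2 * \sum_(c | 0 < Z c c) (Z c c - Z j j)^-1 * H (ev p) c * H c j
          + 2 / (- Z j j) * \sum_q Pi_plus H00 p q * H (ev q) j) /\
     (* a, b in Omega_- *)
     (forall i j, Z i i < 0 -> Z j j < 0 ->
        M i j = 2 * \sum_(c | 0 < Z c c)
          Z c c / ((Z c c - Z i i) * (Z c c - Z j j)) * H i c * H c j))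
  /\
  (forall Z H W Q : 'M[R]_n,
     symmx Z -> symmx H -> symmx W -> Q^T *m Q = 1%:M ->
     is_diag_mx (Q^T *m Z *m Q) ->
     [/\ cvg (dd1_quot Z H @ 0^'+), cvg (dd2_quot Z H W @ 0^'+) &
     Pi_plus'' Z H W =
       Q *m Pi_plus'' (Q^T *m Z *m Q) (Q^T *m H *m Q) (Q^T *m W *m Q) *m Q^T]).
Proof.
split=> [Z H W dZ sH sW M ev H00 V0|Z H W Q sZ sH sW QQ dQ].
  have e1 := expands1_diag dZ sH; have [c1 _] := expands1_lim e1.
  have [c2 ME] := expands2_lim e1 (expands2_diag dZ sH sW).
  have [c3 _] := expands1_lim (Pi_plus'_expand (sub00_sym Z sH) (V00_sym Z sH sW)).
  rewrite {}/M ME; split; first by split=> //; exact: d2Pi_plus_sym.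
  split; first exact: d2Pi_plus_pos_pos.
  split; first exact: d2Pi_plus_pos_zero.
  split; first exact: d2Pi_plus_pos_neg.
  split; first exact: d2Pi_plus_zero_zero.
  by split; [exact: d2Pi_plus_zero_neg | exact: d2Pi_plus_neg_neg].
(* Both expansions at the diagonal matrix are conjugated back by Q, and the limits are read off
   again. *)
have [sH' sW'] := (symmx_conj Q sH, symmx_conj Q sW).
have e1 := expands1_diag dQ sH'; have e2 := expands2_diag dQ sH' sW'.
have [_ ->] := expands2_lim e1 e2.
have e1' := expands1_conj QQ sZ sH e1.
have [c1 _] := expands1_lim e1'.
by have [c2 ->] := expands2_lim e1' (expands2_conj QQ sZ sH sW e2).
Qed.
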